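(* With $G_c(y,q)=(yq;q)_\infty F_c(y,q)$, we have \begin{align*} G_{(4,0,0)}(y,q)&=\sum_{n_1=0}^\infty\sum_{n_2=0}^{2n_1} y^{n_1}\frac{q^{n_1^2+n_2^2-n_1n_2+n_1+n_2}}{(q;q)_{n_1}}\begin{bmatrix}2n_1\\ n_2\end{bmatrix}_q,\\ G_{(3,1,0)}(y,q)&=\sum_{n_1=0}^\infty\sum_{n_2=0}^{2n_1} y^{n_1}\frac{q^{n_1^2+n_2^2-n_1n_2+n_2}}{(q;q)_{n_1}}\begin{bmatrix}2n_1\\ n_2\end{bmatrix}_q,\\ G_{(3,0,1)}(y,q)&=\sum_{n_1=0}^\infty\sum_{n_2=0}^{2n_1} y^{n_1}q^{n_1^2+n_2^2-n_1n_2}\frac{q^{n_1}}{(q;q)_{n_1}}\begin{bmatrix}2n_1\\ n_2\end{bmatrix}_q+\sum_{n_1=1}^\infty\sum_{n_2=0}^{2n_1-2} y^{n_1}q^{n_1^2+n_2^2-n_1n_2}\frac{q^{2n_2}}{(q;q)_{n_1-1}}\begin{bmatrix}2n_1-2\\ n_2\end{bmatrix}_q,\\ G_{(2,2,0)}(y,q)&=\sum_{n_1=0}^\infty\sum_{n_2=0}^{2n_1} y^{n_1}q^{n_1^2+n_2^2-n_1n_2}\frac{q^{n_1}}{(q;q)_{n_1}}\begin{bmatrix}2n_1\\ n_2\end{bmatrix}_q+\sum_{n_1=1}^\infty\sum_{n_2=0}^{2n_1-2} y^{n_1}q^{n_1^2+n_2^2-n_1n_2}\frac{q^{n_2}(1+q^{n_1+n_2})}{(q;q)_{n_1-1}}\begin{bmatrix}2n_1-2\\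 n_2\end{bmatrix}_q,\\ G_{(2,1,1)}(y,q)&=\sum_{n_1=0}^\infty\sum_{n_2=0}^{2n_1} y^{n_1}\frac{q^{n_1^2+n_2^2-n_1n_2}}{(q;q)_{n_1}}\begin{bmatrix}2n_1\\ n_2\end{bmatrix}_q. \end{align*}
   Context: Partitions are weakly decreasing sequences $\lambda=(\lambda_1,\lambda_2,\ldots)$ of nonnegative integers with finitely many nonzero terms. For a composition $c=(c_1,\ldots,c_k)$ into $k$ nonnegative parts, a cylindric partition of profile $c$ is a sequence $\Lambda=(\lambda^{(1)},\ldots,\lambda^{(k)})$ of $k$ partitions such that $\lambda^{(i)}_j\ge\lambda^{(i+1)}_{j+c_{i+1}}$ for all $1\le i\le k-1$ and all $j\ge1$, and $\lambda^{(k)}_j\ge\lambda^{(1)}_{j+c_1}$ for all $j\ge1$. Set $|\Lambda|=\sum_i\sum_{j\ge1}\lambda^{(i)}_j$, $\max(\Lambda)=\max(\lambda^{(1)}_1,\ldots,\lambda^{(k)}_1)$, and $F_c(y,q)=\sum_\Lambda q^{|\Lambda|}y^{\max(\Lambda)}$, summed over all cylindric partitions of profile $c$ (formal power series in $y,q$). Notation: $(a;q)_\infty=\prod_{i\ge0}(1-aq^i)$, $(a;q)_n=\prod_{i=0}^{n-1}(1-aq^i)$, $\begin{bmatrix}n\\ k\end{bmatrix}_q=\frac{(q;q)_n}{(q;q)_k(q;q)_{n-k}}$ for $0\le k\le n$. *)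

(* Defs.v *)
From HB Require Import structures.
From mathcomp Require Import all_boot all_order all_algebra.
From mathcomp Require Import finmap.
From mathcomp Require Import all_classical.

Set Implicit Arguments.
Unset Strict Implicit.
Unset Printing Implicit Defensive.

Import Order.TTheory GRing.Theory Num.Theory.

Local Open Scope classical_set_scope.
Local Open Scope ring_scope.

Record fps (R : Type) := FPS { fcoef :> nat -> R }.

Lemma fpsP (R : Type) (f g : fps R) : (forall n, f n = g n) <-> f = g.
Proof.
split=> [|->//]; case: f g => [f] [g] /= eqfg.
by congr FPS; apply/funext.
Qed.

HB.instance Definition _ (R : Type) := gen_eqMixin (fps R).
HB.instance Definition _ (R : Type) := gen_choiceMixin (fps R).

Section FpsRing.
Variable R : comUnitRingType.
Implicit Types f g h : fps R.

Definition fps_zero : fps R := FPS (fun=> 0).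
Definition fps_opp f : fps R := FPS (fun n => - f n).
Definition fps_add f g : fps R := FPS (fun n => f n + g n).

Lemma fps_addA : associative fps_add.
Proof. by move=> f g h; apply/fpsP => n /=; rewrite addrA. Qed.
Lemma fps_addC : commutative fps_add.
Proof. by move=> f g; apply/fpsP => n /=; rewrite addrC. Qed.
Lemma fps_add0 : left_id fps_zero fps_add.
Proof. by move=> f; apply/fpsP => n /=; rewrite add0r. Qed.
Lemma fps_addN : left_inverse fps_zero fps_opp fps_add.
Proof. by move=> f; apply/fpsP => n /=; rewrite addNr. Qed.

HB.instance Definition _ :=
  GRing.isZmodule.Build (fps R) fps_addA fps_addC fps_add0 fps_addN.

Definition fpsC (a : R) : fps R := FPS (fun n => if n == 0%N then a else 0).
Definition fpsX : fps R := FPS (fun n => if n == 1%N then 1 else 0).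
Definition fps_mul f g : fps R :=
  FPS (fun n => \sum_(i < n.+1) f i * g (n - i)%N).

Definition fps_trunc n f : {poly R} := \poly_(i < n.+1) f i.

Lemma coef_fps_trunc n f i : (i <= n)%N -> (fps_trunc n f)`_i = f i.
Proof. by move=> le_in; rewrite coef_poly ltnS le_in. Qed.

Lemma coef_fps_mul n f g (p r : {poly R}) :
  (forall i, (i <= n)%N -> p`_i = f i) ->
  (forall i, (i <= n)%N -> r`_i = g i) ->
  forall i, (i <= n)%N -> (p * r)`_i = fps_mul f g i.
Proof.
move=> pf rg i le_in; rewrite coefM; apply: eq_bigr => j _.
have le_ji : (j <= i)%N by rewrite -ltnS.
by rewrite pf ?(leq_trans le_ji) // rg // (leq_trans (leq_subr _ _)).
Qed.

Lemma fps_mulA : associative fps_mul.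
Proof.
move=> f g h; apply/fpsP => n; have tE := @coef_fps_trunc n.
rewrite -(coef_fps_mul (tE f) (coef_fps_mul (tE g) (tE h))) //.
by rewrite -(coef_fps_mul (coef_fps_mul (tE f) (tE g)) (tE h)) // mulrA.
Qed.

Lemma fps_mulC : commutative fps_mul.
Proof.
move=> f g; apply/fpsP => n; have tE := @coef_fps_trunc n.
by rewrite -(coef_fps_mul (tE f) (tE g)) // mulrC (coef_fps_mul (tE g) (tE f)).
Qed.

Lemma fps_mul1 : left_id (fpsC 1) fps_mul.
Proof.
move=> f; apply/fpsP => n /=.
rewrite big_ord_recl /= mul1r subn0 big1 ?addr0 // => i _.
by rewrite /= mul0r.
Qed.

Lemma fps_mulDl : left_distributive fps_mul fps_add.
Proof.
move=> f g h; apply/fpsP => n /=; rewrite -big_split /=.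
by apply: eq_bigr => i _; rewrite mulrDl.
Qed.

Lemma fps_oner_neq0 : fpsC 1 != 0 :> fps R.
Proof. by apply/eqP => /fpsP/(_ 0%N)/eqP; rewrite /= oner_eq0. Qed.

HB.instance Definition _ :=
  GRing.Zmodule_isComNzRing.Build (fps R)
    fps_mulA fps_mulC fps_mul1 fps_mulDl fps_oner_neq0.

Lemma fps_coefM f g n : (f * g) n = \sum_(i < n.+1) f i * g (n - i)%N.
Proof. by []. Qed.

Definition fps_unit : pred (fps R) := fun f => f 0%N \is a GRing.unit.

(* The first n.+1 coefficients of 1 / f. *)
Fixpoint fps_inv_seq f n : seq R :=
  if n is n'.+1 then
    let s := fps_inv_seq f n' in
    rcons s (- (f 0%N)^-1 * \sum_(i < n'.+1) f i.+1 * s`_(n' - i))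
  else [:: (f 0%N)^-1].

Definition fps_inv f : fps R :=
  if fps_unit f then FPS (fun n => (fps_inv_seq f n)`_n) else f.

Lemma size_fps_inv_seq f n : size (fps_inv_seq f n) = n.+1.
Proof. by elim: n => //= n IHn; rewrite size_rcons IHn. Qed.

Lemma nth_fps_inv_seq f m n : (m <= n)%N ->
  (fps_inv_seq f n)`_m = (fps_inv_seq f m)`_m.
Proof.
elim: n => [|n IHn]; first by rewrite leqn0 => /eqP->.
rewrite leq_eqVlt => /predU1P[->//|lt_mn].
by rewrite /= nth_rcons size_fps_inv_seq lt_mn IHn.
Qed.

Lemma fps_mulVf : {in fps_unit, left_inverse 1 fps_inv *%R}.
Proof.
move=> f uf; rewrite mulrC /fps_inv (uf : fps_unit f).
have {}uf : f 0%N \is a GRing.unit := uf.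
apply/fpsP => -[|n].
  by rewrite fps_coefM big_ord1 /= divrr.
rewrite fps_coefM big_ord_recl subn0 /= nth_rcons size_fps_inv_seq ltnn eqxx.
rewrite mulrA mulrN divrr // mulN1r addrC; apply/eqP; rewrite subr_eq0; apply/eqP.
apply: eq_bigr => i _.
by rewrite -(@nth_fps_inv_seq f (n - i) n) ?leq_subr.
Qed.

Lemma fps_unitPl f g : g * f = 1 -> fps_unit f.
Proof.
move=> /fpsP/(_ 0%N); rewrite fps_coefM big_ord1 /= mulrC => gf1.
by apply/unitrPr; exists (g 0%N).
Qed.

Lemma fps_inv_out : {in [predC fps_unit], fps_inv =1 id}.
Proof.
by move=> f /negbTE nuf; rewrite /fps_inv (nuf : fps_unit f = false).
Qed.

HB.instance Definition _ :=
  GRing.ComNzRing_hasMulInverse.Build (fps R) fps_mulVf fps_unitPl fps_inv_out.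

End FpsRing.

(* Z[[q]][[y]]: the coefficient of y^m q^n in f is [f m n]. *)
Definition series : comUnitRingType := fps (fps int).

Definition y : series := fpsX (fps int).
Definition q : series := fpsC (fpsX int).

(* Sum of the family (f x) for x in A, computed coefficientwise. It is
   meaningful for families in which each monomial occurs in finitely many
   members; [\sum_(x \in A)] is the library's finite-support sum. *)
Definition series_sum (T : choiceType) (A : set T) (f : T -> series) : series :=
  FPS (fun m => FPS (fun n => \sum_(x \in A) f x m n)).

Definition is_series_lim (u : nat -> series) (l : series) : Prop :=
  forall m n, exists N, forall k, (N <= k)%N -> u k m n = l m n.

Definition series_lim (u : nat -> series) : series :=
  xget 0 [set l | is_series_lim u l].

Lemma series_limE (u : nat -> series) (l : series) :
  is_series_lim u l -> series_lim u = l.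
Proof.
move=> ul; have := xgetI 0 (P := [set l | is_series_lim u l]) ul.
rewrite -/(series_lim u) /= => ul'; apply/fpsP => m; apply/fpsP => n.
have [[N1 H1] [N2 H2]] := (ul m n, ul' m n).
by rewrite -(H1 _ (leq_maxl N1 N2)) H2 // leq_maxr.
Qed.

Definition qpoch (a b : series) (n : nat) : series :=
  \prod_(i < n) (1 - a * b ^+ i).

Definition qpoch_inf (a b : series) : series := series_lim (qpoch a b).

Definition qbinom (n k : nat) : series :=
  qpoch q q n / (qpoch q q k * qpoch q q (n - k)).

(* All indices start at 0: [lam j] is the part of index j + 1. *)
Definition is_partition (lam : nat -> nat) : Prop :=
  (forall j, (lam j.+1 <= lam j)%N) /\
  exists N, forall j, (N <= j)%N -> lam j = 0%N.

(* [ordS] is the cyclic successor on 'I_k, so that i = k - 1 gives the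
   condition relating the last partition to the first one. *)
Definition cylindric (k : nat) (c : k.-tuple nat) :
    set ('I_k -> nat -> nat) :=
  [set L | (forall i, is_partition (L i)) /\
     forall i j, (L (ordS i) (j + tnth c (ordS i)) <= L i j)%N].

Definition cyl_size (k : nat) (L : 'I_k -> nat -> nat) : nat :=
  (\sum_(i < k) \big[addn/0]_(j \in [set: nat]) L i j)%N.

Definition cyl_max (k : nat) (L : 'I_k -> nat -> nat) : nat :=
  \max_(i < k) L i 0%N.

Definition Fcyl (k : nat) (c : k.-tuple nat) : series :=
  series_sum (cylindric c) (fun L => q ^+ cyl_size L * y ^+ cyl_max L).

Definition Gcyl (k : nat) (c : k.-tuple nat) : series := qpoch_inf (y * q) q * Fcyl c.

Lemma fps_coefXM (R : comUnitRingType) (f : fps R) n :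
  (fpsX R * f) n = if n is n'.+1 then f n' else 0.
Proof.
rewrite fps_coefM; case: n => [|n]; first by rewrite big_ord1 /= mul0r.
rewrite big_ord_recl /= mul0r add0r big_ord_recl /= mul1r subSS subn0.
by rewrite big1 ?addr0 // => i _; rewrite mul0r.
Qed.

Lemma fps_coefXnM (R : comUnitRingType) (f : fps R) k n :
  (fpsX R ^+ k * f) n = if (n < k)%N then 0 else f (n - k)%N.
Proof.
elim: k n => [|k IHk] n; first by rewrite expr0 mul1r subn0.
by rewrite exprS -mulrA fps_coefXM; case: n => [|n]; rewrite ?IHk.
Qed.

Lemma fps_coefCM (R : comUnitRingType) (a : R) (f : fps R) n :
  (fpsC a * f) n = a * f n.
Proof.
rewrite fps_coefM big_ord_recl subn0 big1 ?addr0 // => i _.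
by rewrite /= mul0r.
Qed.

Lemma fpsCX (R : comUnitRingType) (a : R) k : fpsC a ^+ k = fpsC (a ^+ k).
Proof.
elim: k => [|k IHk]; first by rewrite !expr0.
rewrite !exprS IHk; apply/fpsP => n; rewrite fps_coefCM /=.
by case: eqP => // _; rewrite mulr0.
Qed.

Lemma series_coefMqX (f : series) k m n :
  (q ^+ k * f) m n = if (n < k)%N then 0 else f m (n - k)%N.
Proof. by rewrite /q fpsCX fps_coefCM fps_coefXnM. Qed.

Lemma series_coefMyX (f : series) k m n :
  (y ^+ k * f) m n = if (m < k)%N then 0 else f (m - k)%N n.
Proof. by rewrite /y fps_coefXnM; case: ifP. Qed.

Lemma series_monomialE a b m n :
  (q ^+ a * y ^+ b : series) m n = ((m == b) && (n == a))%:R.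
Proof.
rewrite series_coefMqX -[y ^+ b]mulr1 series_coefMyX /=.
case: ltngtP => [ltna|ltan|->]; rewrite ?andbF // ?andbT.
  case: ltngtP => // [ltbm|->]; first by rewrite subn_eq0 leqNgt ltbm.
  by rewrite subnn /= subn_eq0 leqNgt ltan.
case: ltngtP => // [ltbm|->]; first by rewrite subn_eq0 leqNgt ltbm.
by rewrite !subnn.
Qed.

Lemma qpoch_unit n : qpoch q q n \is a GRing.unit.
Proof.
apply: rpred_prod => i _; rewrite -exprS.
rewrite unfold_in /= /fps_unit unfold_in /= /fps_unit.
suff -> : (1 - q ^+ i.+1 : series) 0%N 0%N = 1 by rewrite unitr1.
have -> : (1 - q ^+ i.+1 : series) 0%N 0%N = 1 - (q ^+ i.+1 : series) 0%N 0%N.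
  by [].
by rewrite -[q ^+ _]mulr1 series_coefMqX subr0.
Qed.

Lemma qpoch_inf_lim : is_series_lim (qpoch (y * q) q) (qpoch_inf (y * q) q).
Proof.
pose l : series := FPS (fun m => FPS (fun n => qpoch (y * q) q n m n)).
suff ql : is_series_lim (qpoch (y * q) q) l.
  by rewrite /qpoch_inf (series_limE ql).
move=> m n; exists n => k; elim: k => [|k IHk].
  by rewrite leqn0 => /eqP->.
rewrite leq_eqVlt => /predU1P[->//|]; rewrite ltnS => lenk.
have -> : qpoch (y * q) q k.+1 =
    qpoch (y * q) q k - q ^+ k.+1 * (qpoch (y * q) q k * y).
  rewrite {1}/qpoch big_ord_recr /= -[y * q * _]mulrA -exprS.
  by rewrite mulrBr mulr1 [y * (_ ^+ _)]mulrC mulrCA.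
set f := qpoch _ _ _; set g := _ * (f * y).
have -> : (f - g) m n = f m n - g m n by [].
by rewrite series_coefMqX ltnS lenk subr0 IHk.
Qed.

Lemma partition_le (lam : nat -> nat) i j :
  is_partition lam -> (i <= j)%N -> (lam j <= lam i)%N.
Proof.
move=> [mono _]; elim: j => [|j IHj]; first by rewrite leqn0 => /eqP->.
rewrite leq_eqVlt => /predU1P[->//|/IHj].
exact: leq_trans (mono j).
Qed.

Lemma partition_sumE (lam : nat -> nat) N :
    (forall j, (N <= j)%N -> lam j = 0%N) ->
  \big[addn/0%N]_(j \in [set: nat]) lam j = (\sum_(j < N) lam j)%N.
Proof.
move=> lam0; rewrite -(fsbig_widen `I_N setT).
- by rewrite -fsbig_ord; apply: eq_bigr.
- by [].
- by move=> j [_ /= /negP]; rewrite -leqNgt => /lam0.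
Qed.

Lemma cyl_size_bound (k : nat) (L : 'I_k -> nat -> nat) i j :
    (forall i, is_partition (L i)) ->
  (L i j <= cyl_size L)%N /\ ((cyl_size L <= j)%N -> L i j = 0%N).
Proof.
move=> Lp; have [_ [N LN]] := Lp i.
have leL s : (s <= \big[addn/0%N]_(j \in [set: nat]) L i j)%N -> (s <= cyl_size L)%N.
  move=> /leq_trans; apply; rewrite /cyl_size (bigD1 i) //=.
  exact: leq_addr.
pose M := maxn N j.+1.
have sumM : \big[addn/0%N]_(j \in [set: nat]) L i j = (\sum_(j < M) L i j)%N.
  by apply: partition_sumE => l; rewrite geq_max => /andP[/LN].
have ltjM : (j < M)%N by rewrite leq_max leqnn orbT.
split.
  apply: leL; rewrite sumM (bigD1 (Ordinal ltjM)) //=; exact: leq_addr.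
move=> lej; apply/eqP; rewrite -leqn0 leqNgt; apply/negP => Lj0.
suff /leL : (j.+1 <= \big[addn/0%N]_(j \in [set: nat]) L i j)%N.
  by rewrite ltnNge lej.
rewrite sumM; apply: (@leq_trans (\sum_(l < j.+1) L i l)%N).
  rewrite -{1}[j.+1]muln1 -{1}[j.+1]card_ord -sum_nat_const.
  apply: leq_sum => l _; apply: leq_trans Lj0 _.
  by apply: partition_le => //; rewrite -ltnS.
rewrite -!(big_mkord xpredT (L i)) (@big_cat_nat _ _ _ j.+1 0 M) //=.
exact: leq_addr.
Qed.

Lemma finite_cylindric (k : nat) (c : k.-tuple nat) n :
  finite_set [set L | cylindric c L /\ cyl_size L = n].
Proof.
pose h (g : {ffun 'I_k * 'I_n -> 'I_n.+1}) (i : 'I_k) (j : nat) : nat :=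
  if insub j is Some l then g (i, l) else 0%N.
apply: (@sub_finite_set _ _ (h @` setT)); last first.
  by apply: finite_image; exact: finite_finset.
move=> L [[Lp _] Ln].
exists [ffun p : 'I_k * 'I_n => inord (L p.1 p.2)] => //.
apply/funext => i; apply/funext => j; rewrite /h.
have [Lle L0] := cyl_size_bound i j Lp; rewrite Ln in Lle L0.
case: insubP => [l _ lj|]; last by rewrite -leqNgt => /L0.
by rewrite ffunE /= lj inordK.
Qed.

Lemma Fcyl_coefE (k : nat) (c : k.-tuple nat) m n :
  Fcyl c m n =
  (#|` fset_set [set L | [/\ cylindric c L, cyl_max L = m & cyl_size L = n]] |)%fset%:R.
Proof.
set A := [set L | _]; have finA : finite_set A.
  by apply: sub_finite_set (finite_cylindric c n) => L [cL _ sL].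
rewrite /Fcyl /series_sum /=.
under eq_fsbigr do rewrite series_monomialE.
rewrite -(fsbig_widen A).
- rewrite (@eq_fsbigr _ _ _ _ _ (fun=> 1)).
    by rewrite fsbig_finite //= big_const_seq count_predT iter_addr_0.
  by move=> L; rewrite inE => -[_ -> ->]; rewrite !eqxx.
- by move=> L [].
move=> L [cL nAL] /=; case: andP => // -[/eqP mE /eqP nE].
by case: nAL; split.
Qed.

Lemma finite_series_support_yX (f : nat -> series) m n :
  finite_set [set k | (y ^+ k * f k) m n != 0].
Proof.
apply: (@sub_finite_set _ _ `I_m.+1); last exact: finite_II.
move=> k; rewrite /mkset series_coefMyX ltnS leqNgt.
by case: ltnP => // _; rewrite eqxx.
Qed.

(* Main.v *)
From HB Require Import structures.
Require Import Defs.
From mathcomp Require Import all_boot all_order all_algebra.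
From mathcomp Require Import finmap.
From mathcomp Require Import all_classical.
From mathcomp Require Import zify ring.

Set Implicit Arguments.
Unset Strict Implicit.
Unset Printing Implicit Defensive.

Import GRing.Theory.
Local Open Scope classical_set_scope.
Local Open Scope ring_scope.

(** Deleting the maximal first parts of the partitions indexed by J from a
    cylindric partition of profile c leaves one of profile c(J).  As the maximum
    is always attained at an index i with c_i > 0, inclusion-exclusion gives the
    Corteel-Welsh equations
      G_c(y) = sum over J of (-1)^(|J|-1) (yq;q)_(|J|-1) G_(c(J))(y q^|J|),
    J ranging over the nonempty subsets of the support of c.  Up to rotation of
    profiles they form a closed system for the five series at hand, which
    determines the coefficient of y^n from that of y^(n-1), since the remaining
    terms are divisible by q^n.

    On the sum side all coefficients are combinations of
      alpha_n = sum_k q^(n^2+k^2-nk) [2n, k] / (q;q)_n   and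
      beta_n  = sum_k q^(n^2+k^2-nk+k) [2n, k] / (q;q)_n,
    for which the q-Pascal rules give a first order recurrence in n; the system
    then reduces to polynomial identities in q and q^(n-1). *)

(** * The Corteel-Welsh equations *)

Definition cyl_of_size (k : nat) (c : k.-tuple nat) (n : nat) :
    set ('I_k -> nat -> nat) :=
  [set L | cylindric c L /\ cyl_size L = n].

(** This is F_c / (1 - y). An upper bound m on the parts, unlike an exact maximum, survives removing
    and inserting first parts equal to m. Fixing the size makes each coefficient a finite sum. *)
Definition Hcyl (k : nat) (c : k.-tuple nat) : series :=
  FPS (fun m => FPS (fun n =>
    \sum_(L \in cyl_of_size c n) ((cyl_max L <= m)%N%:R : int))).

Lemma Fcyl_coef_of_size (k : nat) (c : k.-tuple nat) m n :
  Fcyl c m n = \sum_(L \in cyl_of_size c n) ((cyl_max L == m)%:R : int).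
Proof.
rewrite /Fcyl /series_sum /= -(@fsbig_widen _ _ _ _ (cyl_of_size c n)).
- apply: eq_fsbigr => L; rewrite inE => -[_ Ln].
  by rewrite series_monomialE Ln eqxx andbT eq_sym.
- by move=> L [].
- move=> L [cL nL] /=; rewrite series_monomialE.
  case: (n =P cyl_size L) => [nE|]; last by rewrite andbF.
  by case: nL; split.
Qed.

Lemma Fcyl_Hcyl (k : nat) (c : k.-tuple nat) : Fcyl c = (1 - y) * Hcyl c.
Proof.
apply/fpsP => m; apply/fpsP => n; rewrite mulrBl mul1r.
rewrite Fcyl_coef_of_size.
have -> : (Hcyl c - y * Hcyl c) m n = Hcyl c m n - (y ^+ 1 * Hcyl c) m n by [].
rewrite series_coefMyX /=; apply/eqP; rewrite eq_sym subr_eq; apply/eqP.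
case: m => [|m] /=.
  rewrite addr0; apply: eq_fsbigr => L _; by rewrite leqn0.
rewrite subn1 -fsbig_split; last exact: finite_cylindric.
apply: eq_fsbigr => L _ /=; rewrite leq_eqVlt ltnS.
by case: eqP => [->|]; rewrite ?ltnn ?addr0 ?add0r.
Qed.

Lemma Hcyl_coefy0 (k : nat) (c : k.-tuple nat) : Hcyl c 0%N = 1.
Proof.
have cyl0 : cylindric c (fun _ _ => 0%N) by split=> // i; split=> //; exists 0%N.
have size0 : cyl_size (fun (_ : 'I_k) (_ : nat) => 0%N) = 0%N.
  by rewrite /cyl_size big1 // => i _; rewrite fsbig1.
have max0 L : cylindric c L -> (cyl_max L <= 0)%N -> L = fun _ _ => 0%N.
  move=> [pL _] /bigmax_leqP L0; apply/funext => i; apply/funext => j.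
  apply/eqP; rewrite -leqn0; apply: leq_trans (L0 i isT).
  exact: partition_le.
apply/fpsP => n /=; case: ifPn => [/eqP->|n0].
  rewrite -(@fsbig_widen _ _ _ _ [set (fun _ _ => 0%N)]).
  - rewrite fsbig_set1; case: leqP => //.
    by rewrite ltnNge => /negP[]; apply/bigmax_leqP.
  - by move=> _ ->.
  - move=> L [[cL _] nL] /=; case: (boolP (_ <= 0)%N) => // /(max0 _ cL) L0.
    by case: nL.
rewrite fsbig1 // => L [cL sL]; case: (boolP (_ <= 0)%N) => // /(max0 _ cL) L0.
by rewrite -sL L0 size0 eqxx in n0.
Qed.

Definition rot_profile (k : nat) (c : k.-tuple nat) : k.-tuple nat :=
  [tuple tnth c (ordS i) | i < k].

Lemma cylindric_comp_ordS (k : nat) (c : k.-tuple nat) (L : 'I_k -> nat -> nat) :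
  cylindric (rot_profile c) (L \o @ordS k) <-> cylindric c L.
Proof.
split=> -[pL cL]; split=> i; try exact: pL.
- by rewrite -[i]ord_predK; exact: pL.
- move=> j; have := cL (ord_pred i) j.
  by rewrite /rot_profile tnth_mktuple /= ord_predK.
- by move=> j; rewrite /rot_profile tnth_mktuple /=; exact: cL.
Qed.

(** A cyclic shift of the index permutes the k inequalities and preserves size and maximum. This
    identifies the rotated profiles that the recurrence produces. *)
Lemma Hcyl_rot (k : nat) (c : k.-tuple nat) : Hcyl (rot_profile c) = Hcyl c.
Proof.
have maxE (L : 'I_k -> nat -> nat) : cyl_max (L \o @ordS k) = cyl_max L.
  rewrite /cyl_max [RHS](reindex (@ordS k)) //.
  by apply: onW_bij; exact: ordS_bij.
have sizeE (L : 'I_k -> nat -> nat) : cyl_size (L \o @ordS k) = cyl_size L.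
  rewrite /cyl_size [RHS](reindex (@ordS k)) //.
  by apply: onW_bij; exact: ordS_bij.
apply/fpsP => m; apply/fpsP => n /=.
rewrite (@reindex_fsbig _ _ _ _ _
  (fun L : 'I_k -> nat -> nat => L \o @ordS k) (cyl_of_size c n)).
  by apply: eq_fsbigr => L _; rewrite maxE.
split.
- by move=> L [cL sL]; split; [apply/cylindric_comp_ordS|rewrite sizeE].
- move=> L1 L2 _ _ /= L12; apply/funext => i.
  by have := congr1 (@^~ (ord_pred i)) L12; rewrite /= ord_predK.
- move=> L [cL sL]; exists (L \o @ord_pred k).
    have LE : (L \o @ord_pred k) \o @ordS k = L.
      by apply/funext => i /=; rewrite ordSK.
    split; last by rewrite -sizeE LE.
    by apply/cylindric_comp_ordS; rewrite LE.
  by apply/funext => i /=; rewrite ordSK.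
Qed.

(* The substitution y -> y q^j. *)
Definition ydil (j : nat) (f : series) : series :=
  FPS (fun m => fpsX int ^+ (m * j) * f m).

Lemma ydil_coef (j : nat) (f : series) (m n : nat) :
  ydil j f m n = if (n < m * j)%N then 0 else f m (n - m * j)%N.
Proof. exact: fps_coefXnM. Qed.

(** The profile c(J). Deleting the first parts in J moves the index by one on the larger side of the
    i-th inequality when i - 1 is in J, and on the smaller side when i is in J. *)
Definition shift_profile (k : nat) (c : k.-tuple nat) (J : {set 'I_k}) :
    k.-tuple nat :=
  [tuple (tnth c i + (ord_pred i \in J) - (i \in J))%N | i < k].

Definition strip (k : nat) (J : {set 'I_k}) (L : 'I_k -> nat -> nat) :=
  fun i j => L i (j + (i \in J))%N.

Definition cap (k : nat) (J : {set 'I_k}) (m : nat) (L : 'I_k -> nat -> nat) :=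
  fun i j => if (j < (i \in J))%N then m else L i (j - (i \in J))%N.

Lemma capK (k : nat) (J : {set 'I_k}) (m : nat) : cancel (cap J m) (strip J).
Proof.
move=> L; apply/funext => i; apply/funext => j.
by rewrite /strip /cap ltnNge leq_addl addnK.
Qed.

Lemma stripK (k : nat) (J : {set 'I_k}) (m : nat) (L : 'I_k -> nat -> nat) :
  (forall i, i \in J -> L i 0%N = m) -> cap J m (strip J L) = L.
Proof.
move=> Lm; apply/funext => i; apply/funext => j.
rewrite /strip /cap; case: (boolP (i \in J)) => [/Lm Li|_] /=.
  by case: j => [|j]; rewrite //= subnK.
by rewrite subn0 addn0.
Qed.

Section Shift.
Variables (k : nat) (c : k.-tuple nat) (J : {set 'I_k}).
Hypothesis Jc : forall i, i \in J -> (0 < tnth c i)%N.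

(** Positivity of c on J makes the truncated subtraction in c(J) exact. In this form it matches the
    indices in both transfer lemmas below. *)
Lemma shift_profileE (i : 'I_k) :
  (tnth (shift_profile c J) (ordS i) + (ordS i \in J) =
   tnth c (ordS i) + (i \in J))%N.
Proof.
rewrite tnth_mktuple ordSK subnK //.
by case: (boolP (_ \in J)) => // /Jc lt0; apply: leq_trans (leq_addr _ _).
Qed.

Lemma cylindric_strip (L : 'I_k -> nat -> nat) :
  cylindric c L -> cylindric (shift_profile c J) (strip J L).
Proof.
move=> [pL cL]; split=> [i|i j]; rewrite /strip.
  split=> [j|]; first exact: (pL i).1.
  have [N LN] := (pL i).2; exists N => j Nj.
  by rewrite LN // (leq_trans Nj) ?leq_addr.
by rewrite -addnA shift_profileE addnCA addnC; exact: cL.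
Qed.

(** All parts are at most m, so the inequalities whose larger side is an inserted m are free; the
    others are inequalities of [L] after moving indices. *)
Lemma cylindric_cap (m : nat) (L : 'I_k -> nat -> nat) : (cyl_max L <= m)%N ->
  cylindric (shift_profile c J) L -> cylindric c (cap J m L).
Proof.
move=> /bigmax_leqP Lm [pL cL].
have leLm i j : (L i j <= m)%N.
  by apply: leq_trans (Lm i isT); exact: partition_le.
have le_capm i j : (cap J m L i j <= m)%N by rewrite /cap; case: ifP.
split=> [i|i j].
  have [_ [N LN]] := pL i; split=> [j|].
    rewrite {2}/cap; case: ltnP => // leJj.
    by rewrite /cap ltnNge leqW // subSn //=; exact: (pL i).1.
  exists N.+1 => j Nj; rewrite /cap ltnNge.
  have leJ : ((i \in J) <= 1)%N by case: (_ \in _).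
  have -> /= : ((i \in J) <= j)%N by apply: leq_trans leJ (leq_trans _ Nj).
  by apply: LN; move: leJ Nj; lia.
rewrite {2}/cap; case: ltnP => // leJj.
have idxE : (j + tnth c (ordS i) =
    j - (i \in J) + tnth (shift_profile c J) (ordS i) + (ordS i \in J))%N.
  by rewrite -addnA shift_profileE addnCA addnC subnK // addnC.
by rewrite idxE /cap ltnNge leq_addl /= addnK; exact: cL.
Qed.

End Shift.

Lemma cyl_size_cap (k : nat) (J : {set 'I_k}) (m : nat) (L : 'I_k -> nat -> nat) :
  (forall i, is_partition (L i)) -> cyl_size (cap J m L) = (m * #|J| + cyl_size L)%N.
Proof.
move=> pL; rewrite /cyl_size mulnC -sum_nat_const [X in (X + _)%N]big_mkcond.
rewrite -big_split /=; apply: eq_bigr => i _; have [_ [N LN]] := pL i.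
rewrite (partition_sumE LN) /cap; case: (i \in J) => /=.
  rewrite (@partition_sumE _ N.+1) => [|[|j] Nj //=]; last by rewrite subn1 LN.
  rewrite big_ord_recl /=; congr addn.
  by apply: eq_bigr => j _; rewrite subn1.
rewrite (@partition_sumE _ N) => [|j /LN]; last by rewrite subn0.
by apply: eq_bigr => j _; rewrite subn0.
Qed.

Lemma cyl_max_cap (k : nat) (J : {set 'I_k}) (m : nat) (L : 'I_k -> nat -> nat) :
  (cyl_max L <= m)%N -> (cyl_max (cap J m L) <= m)%N.
Proof.
move=> /bigmax_leqP Lm; apply/bigmax_leqP => i _; rewrite /cap.
by case: ifP => // _; rewrite sub0n; exact: Lm.
Qed.

Lemma cyl_max_strip (k : nat) (J : {set 'I_k}) (m : nat) (L : 'I_k -> nat -> nat) :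
  (forall i, is_partition (L i)) ->
  (cyl_max L <= m)%N -> (cyl_max (strip J L) <= m)%N.
Proof.
move=> pL /bigmax_leqP Lm; apply/bigmax_leqP => i _.
by apply: leq_trans (Lm i isT); exact: partition_le.
Qed.

(* Deleting the first part, equal to m, of each partition in J. *)
Lemma count_cap (k : nat) (c : k.-tuple nat) (J : {set 'I_k}) (m n : nat) :
    (forall i, i \in J -> (0 < tnth c i)%N) ->
  \sum_(L \in cyl_of_size c n)
    (((cyl_max L <= m)%N && [forall (i | i \in J), L i 0%N == m])%:R : int) =
  ydil #|J| (Hcyl (shift_profile c J)) m n.
Proof.
move=> Jc; rewrite ydil_coef.
pose A := [set L | [/\ cyl_of_size c n L, (cyl_max L <= m)%N
                     & forall i, i \in J -> L i 0%N = m]].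
have -> : \sum_(L \in cyl_of_size c n)
    (((cyl_max L <= m)%N && [forall (i | i \in J), L i 0%N == m])%:R : int) =
    \sum_(L \in A) (1 : int).
  rewrite -(@fsbig_widen _ _ _ _ A).
  - apply: eq_fsbigr => L; rewrite inE => -[_ -> Lm] /=.
    by case: forall_inP => // -[] i /Lm ->.
  - by move=> L [].
  - move=> L [sL nL] /=; case: andP => // -[Lm /forall_inP LJ].
    by case: nL; split=> // i /LJ /eqP.
(* Inserting m in |J| places adds m|J| to the size. So nothing is counted when n < m|J|; otherwise
   [cap J m] maps the set [B] below, of size n - m|J|, bijectively onto [A]. *)
case: ltnP => [ltn|len].
  rewrite fsbig1 // => L [[cL sL] _ Lm]; move: ltn; rewrite -sL.
  rewrite -(stripK Lm) cyl_size_cap ?ltnNge ?leq_addr //.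
  by case: (cylindric_strip Jc cL).
pose B := [set L | cyl_of_size (shift_profile c J) (n - m * #|J|) L
                   /\ (cyl_max L <= m)%N].
rewrite /= -[RHS](@fsbig_widen _ _ _ _ B); last 2 first.
- by move=> L [].
- by move=> L [sL nL] /=; case: (boolP (_ <= m)%N) => // Lm; case: nL.
rewrite (@reindex_fsbig _ _ _ _ _ (cap J m) B).
  by apply: eq_fsbigr => L; rewrite inE => -[_ ->].
split.
- move=> L [[cL sL] Lm]; split.
  + split; first exact: cylindric_cap.
    by rewrite cyl_size_cap ?sL ?subnKC //; case: cL.
  + exact: cyl_max_cap.
  + by move=> i iJ; rewrite /cap iJ.
- by move=> L1 L2 _ _ /(can_inj (capK J m)).
- move=> L [[cL sL] Lm LJ]; exists (strip J L); last exact: stripK.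
  have csL := cylindric_strip Jc cL.
  split; last by apply: cyl_max_strip => //; case: cL.
  split=> //; rewrite -sL -[in X in (X - _)%N](stripK LJ) cyl_size_cap ?addKn //.
  by case: csL.
Qed.

(** Expand the product over i in A of 1 - [P i]. Factors outside A are written 0 + 1, which discards
    the subsets J not contained in A. *)
Lemma incl_excl (I : finType) (A : {set I}) (P : pred I) :
  \sum_(J : {set I} | J \subset A) (-1) ^+ #|J| * [forall (i | i \in J), P i]%:R =
  [forall (i | i \in A), ~~ P i]%:R :> int.
Proof.
have prodE (B : {set I}) (Q : pred I) :
    \prod_(i in B) (Q i)%:R = [forall (i | i \in B), Q i]%:R :> int.
  case: forall_inP => [QB|/forall_inP/forall_inPn[i iB /negbTE nQ]].
    by rewrite big1 // => i /QB ->.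
  by rewrite (bigD1 i) //= nQ mul0r.
transitivity (\prod_(i : I) ((if i \in A then - (P i)%:R else 0) + 1) : int).
  rewrite bigA_distr big_mkcond; apply: eq_bigr => J _.
  rewrite -big_mkcond /=; case: ifPn => [JA|].
    rewrite -prodE -prodrN; apply: eq_bigr => i iJ.
    by rewrite (fintype.subsetP JA).
  by case/fintype.subsetPn => i iJ iA; rewrite (bigD1 i) //= (negbTE iA) mul0r.
rewrite -prodE [RHS]big_mkcond; apply: eq_bigr => i _.
by case: (i \in A); case: (P i).
Qed.

(** Walking backwards from [i1] reaches 0, steps round to the last index, and continues down through
    every index. *)
Lemma ordS_ind (k : nat) (P : 'I_k -> Prop) (i1 : 'I_k) :
  (forall i, P (ordS i) -> P i) -> P i1 -> forall i, P i.
Proof.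
case: k => [|k] in P i1 *; first by case: i1.
move=> step P1; have desc d (i j : 'I_k.+1) : (j + d = i)%N -> P i -> P j.
  elim: d i => [|d IHd] i; first by rewrite addn0 => /val_inj ->.
  move=> ij Pi; have ltd : (j + d < k.+1)%N by have := ltn_ord i; lia.
  apply: (IHd (Ordinal ltd)) => //; apply: step; rewrite (_ : ordS _ = i) //.
  by apply: val_inj; rewrite /= -addnS ij modn_small.
move=> i; apply: (desc (k - i)%N ord_max).
  by rewrite /= subnKC // -ltnS.
apply: step; rewrite (_ : ordS _ = ord0).
  exact: (desc i1 i1).
by apply: val_inj; rewrite /= modnn.
Qed.

Definition profile_support (k : nat) (c : k.-tuple nat) : {set 'I_k} :=
  finset (fun i => (0 < tnth c i)%N).

(* If c_(i+1) = 0 then the first part of the (i+1)-st partition is at most that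
   of the i-th one, so the maximum is attained on the support of c. *)
Lemma cyl_max_support (k : nat) (c : k.-tuple nat) (i0 : 'I_k)
    (L : 'I_k -> nat -> nat) (m : nat) :
    (0 < tnth c i0)%N -> cylindric c L -> (cyl_max L <= m)%N ->
  [forall (i | i \in profile_support c), L i 0%N != m] = (cyl_max L < m)%N.
Proof.
move=> c0 [pL cL] Lm; apply/forall_inP/idP => [LI|ltm i _]; last first.
  by rewrite neq_ltn (leq_ltn_trans _ ltm) //; exact: leq_bigmax.
rewrite ltn_neqAle Lm andbT; apply/eqP => maxE.
have [i1 maxE1] : {i1 | cyl_max L = L i1 0%N}.
  by apply: eq_bigmax; rewrite card_ord; case: (k) i0 {c0} => // -[].
have Lle i : (L i 0%N <= m)%N by rewrite -maxE; exact: leq_bigmax.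
suff Lall : forall i, L i 0%N = m.
  by have := LI i0; rewrite inE c0 Lall eqxx => /(_ isT).
apply: (@ordS_ind _ _ i1); last by rewrite -maxE1.
move=> i LSi; case: (posnP (tnth c (ordS i))) => [ci|ci].
  by apply/eqP; rewrite eqn_leq Lle -LSi; have := cL i 0%N; rewrite ci.
by have := LI (ordS i); rewrite inE ci LSi eqxx => /(_ isT).
Qed.

Lemma series_coef_sum (I : Type) (r : seq I) (P : pred I) (f : I -> series) m n :
  (\sum_(i <- r | P i) f i) m n = \sum_(i <- r | P i) f i m n.
Proof. exact: (big_morph (fun f : series => f m n)). Qed.

Lemma series_coef_sign (f : series) j m n :
  ((-1) ^+ j * f) m n = (-1) ^+ j * f m n.
Proof.
by rewrite -signr_odd -[in RHS]signr_odd !mulr_sign; case: (odd j).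
Qed.

(** By [count_cap] the J-term counts, with sign, the partitions of maximum at most m whose first
    parts in J equal m. Inclusion-exclusion leaves those with no first part m on the support, hence
    of maximum below m, and y H_c counts these. *)
Lemma Hcyl_recurrence (k : nat) (c : k.-tuple nat) (i0 : 'I_k) :
    (0 < tnth c i0)%N ->
  \sum_(J : {set 'I_k} | J \subset profile_support c)
    (-1) ^+ #|J| * ydil #|J| (Hcyl (shift_profile c J)) = y * Hcyl c.
Proof.
move=> c0; apply/fpsP => m; apply/fpsP => n.
have finS := finite_cylindric c n.
rewrite series_coef_sum -[y]expr1 series_coefMyX.
transitivity (\sum_(L \in cyl_of_size c n) ((cyl_max L < m)%N%:R : int)).
  transitivity (\sum_(J : {set 'I_k} | J \subset profile_support c)
      \sum_(L <- fset_set (cyl_of_size c n)) (-1) ^+ #|J| *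
    (((cyl_max L <= m)%N && [forall (i | i \in J), L i 0%N == m])%:R : int)).
    apply: eq_bigr => J /fintype.subsetP JA; rewrite series_coef_sign -count_cap.
      by rewrite fsbig_finite // mulr_sumr.
    by move=> i /JA; rewrite inE.
  rewrite exchange_big fsbig_finite //; apply: eq_big_seq => L.
  rewrite in_fset_set // inE => -[cL sL] /=.
  case: (boolP (cyl_max L <= m)%N) => [Lm|]; last first.
    rewrite -ltnNge => ltm; rewrite big1 => [|J _]; last by rewrite mulr0.
    by rewrite ltnNge ltnW.
  rewrite -(cyl_max_support c0 cL Lm).
  exact: (incl_excl (profile_support c) (fun i => L i 0%N == m)).
case: m => [|m] /=; first by rewrite fsbig1.
by rewrite subn1.
Qed.

(** * Dilation in y and the passage from [Hcyl] to [Gcyl] *)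

Lemma ydilE (j : nat) (f : series) (m : nat) :
  ydil j f m = fpsX int ^+ (m * j) * f m.
Proof. by []. Qed.

Lemma ydilM (j : nat) (f g : series) : ydil j (f * g) = ydil j f * ydil j g.
Proof.
apply/fpsP => m; rewrite ydilE !fps_coefM mulr_sumr.
apply: eq_bigr => i _; rewrite !ydilE mulrACA -exprD -mulnDl subnKC //.
by rewrite -ltnS.
Qed.

Lemma ydilB (j : nat) (f g : series) : ydil j (f - g) = ydil j f - ydil j g.
Proof. by apply/fpsP => m; rewrite ydilE mulrBr. Qed.

Lemma ydilD (j : nat) (f g : series) : ydil j (f + g) = ydil j f + ydil j g.
Proof. by apply/fpsP => m; rewrite ydilE mulrDr. Qed.

Lemma ydil1 (j : nat) : ydil j 1 = 1.
Proof. by apply/fpsP => -[|m]; rewrite ydilE ?mul1r //= mulr0. Qed.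

Lemma ydil0 (f : series) : ydil 0 f = f.
Proof. by apply/fpsP => m; rewrite ydilE muln0 mul1r. Qed.

Lemma ydil_add (i j : nat) (f : series) : ydil i (ydil j f) = ydil (i + j) f.
Proof. by apply/fpsP => m; rewrite !ydilE mulrA -exprD -mulnDr. Qed.

Lemma ydily (j : nat) : ydil j y = y * q ^+ j.
Proof.
apply/fpsP => m; rewrite ydilE [y * _]mulrC /q fpsCX fps_coefCM.
by case: m => [|[|m]]; rewrite ?mulr0 //= mul1n.
Qed.

Lemma ydilq (i j : nat) : ydil j (q ^+ i) = q ^+ i.
Proof. by apply/fpsP => -[|m]; rewrite ydilE ?mul1r // /q fpsCX /= mulr0. Qed.

Lemma qpochS (a b : series) (n : nat) :
  qpoch a b n.+1 = qpoch a b n * (1 - a * b ^+ n).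
Proof. by rewrite /qpoch big_ord_recr. Qed.

(** The finite products satisfy it with [i.+1] factors on the left and [i] on the right. A given
    coefficient of the right side involves at most two coefficients of the dilated product, so the
    limit can be taken coefficientwise. *)
Lemma qpoch_inf_ydil1 :
  qpoch_inf (y * q) q = (1 - y * q) * ydil 1 (qpoch_inf (y * q) q).
Proof.
have uE i : qpoch (y * q) q i.+1 = (1 - y * q) * ydil 1 (qpoch (y * q) q i).
  elim: i => [|i IHi].
    by rewrite /qpoch big_ord1 big_ord0 ydil1 expr0 !mulr1.
  rewrite [LHS]qpochS [in LHS]IHi [in RHS]qpochS ydilM -mulrA ydilB ydil1.
  by rewrite !ydilM ydily -[q in RHS]expr1 !ydilq expr1 -!mulrA -!exprS.
apply: series_limE => m n.
set P := qpoch_inf _ _.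
have coefE (f : series) : ((1 - y * q) * f) m n =
    f m n - (if (m < 1)%N then 0 else if (n < 1)%N then 0 else f (m - 1)%N (n - 1)%N).
  rewrite mulrBl mul1r -mulrA.
  have -> : (f - y * (q * f)) m n = f m n - (y ^+ 1 * (q ^+ 1 * f)) m n by [].
  by rewrite series_coefMyX; case: ltnP => // _; rewrite series_coefMqX.
have [N1 H1] := qpoch_inf_lim m (n - m * 1)%N.
have [N2 H2] := qpoch_inf_lim (m - 1)%N (n - 1 - (m - 1) * 1)%N.
exists (maxn N1 N2).+1 => -[|i] //; rewrite ltnS geq_max => /andP[N1i N2i].
by rewrite uE !coefE !ydil_coef H1 // H2.
Qed.

Lemma qpoch_inf_ydil (j : nat) :
  qpoch_inf (y * q) q = qpoch (y * q) q j * ydil j (qpoch_inf (y * q) q).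
Proof.
elim: j => [|j IHj]; first by rewrite /qpoch big_ord0 mul1r ydil0.
rewrite {1}IHj {1}qpoch_inf_ydil1 ydilM ydil_add addn1 mulrA.
congr (_ * _); rewrite qpochS; congr (_ * _).
by rewrite ydilB ydil1 ydilM ydily -[q]expr1 ydilq expr1 -!mulrA [q * _]mulrC.
Qed.

(** In [Fcyl c = (1 - y) * Hcyl c] dilation turns 1 - y into 1 - y q^(j+1), the last factor of
    (yq;q)_(j+1); what is left over is (yq;q)_j. *)
Lemma Gcyl_ydil (k : nat) (c : k.-tuple nat) (j : nat) :
  qpoch_inf (y * q) q * ydil j.+1 (Hcyl c) =
  qpoch (y * q) q j * ydil j.+1 (Gcyl c).
Proof.
rewrite /Gcyl Fcyl_Hcyl !ydilM {1}(qpoch_inf_ydil j.+1).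
rewrite qpochS ydilB ydil1 ydily.
by rewrite -!mulrA -exprS; congr (_ * _); rewrite mulrCA.
Qed.

Lemma shift_profile0 (k : nat) (c : k.-tuple nat) : shift_profile c finset.set0 = c.
Proof.
by apply: eq_from_tnth => i; rewrite tnth_mktuple !inE addn0 subn0.
Qed.

(** Multiply [Hcyl_recurrence] by the infinite product. The empty set contributes H_c, and H_c - y
    H_c = F_c, so the remaining terms change sign. *)
Lemma Gcyl_recurrence (k : nat) (c : k.-tuple nat) (i0 : 'I_k) :
    (0 < tnth c i0)%N ->
  Gcyl c = \sum_(J : {set 'I_k} | (J \subset profile_support c) && (J != finset.set0))
    (-1) ^+ #|J|.-1 *
    (qpoch (y * q) q #|J|.-1 * ydil #|J| (Gcyl (shift_profile c J))).
Proof.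
move=> c0; have := Hcyl_recurrence c0; rewrite (bigD1 finset.set0) ?finset.sub0set //=.
rewrite cards0 expr0 mul1r ydil0 shift_profile0 => HE.
have -> : Gcyl c = qpoch_inf (y * q) q * (Hcyl c - y * Hcyl c).
  by rewrite /Gcyl Fcyl_Hcyl mulrBl mul1r.
rewrite -HE opprD addrA subrr add0r -sumrN mulr_sumr; apply: eq_bigr => J.
case/andP=> _; rewrite -card_gt0; case: #|J| => // j _ /=.
by rewrite -Gcyl_ydil exprS mulN1r !mulNr opprK mulrCA.
Qed.

(** * The profiles of three parts with sum 4 *)

(** Three booleans parametrize the subsets of ['I_3], so that a sum over J unfolds into eight
    explicit terms. *)
Definition set3 (b0 b1 b2 : bool) : {set 'I_3} :=
  finset (fun i : 'I_3 => nth false [:: b0; b1; b2] i).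

Lemma big_set3 (P : pred {set 'I_3}) (f : {set 'I_3} -> series) :
  \sum_(J | P J) f J = \sum_(b0 : bool) \sum_(b1 : bool) \sum_(b2 : bool)
    if P (set3 b0 b1 b2) then f (set3 b0 b1 b2) else 0.
Proof.
pose h (b : bool * bool * bool) := set3 b.1.1 b.1.2 b.2.
rewrite (reindex h) /=; last first.
  pose o0 := @Ordinal 3 0 isT; pose o1 := @Ordinal 3 1 isT.
  pose o2 := @Ordinal 3 2 isT.
  apply: onW_bij; exists (fun J : {set 'I_3} => (o0 \in J, o1 \in J, o2 \in J)).
    by move=> [[b0 b1] b2]; rewrite !inE.
  move=> J; apply/setP => -[[|[|[|i]]] lti]; rewrite inE //=;
    by congr (_ \in J); exact: val_inj.
by rewrite big_mkcond pair_bigA pair_bigA.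
Qed.

Lemma card_set3 b0 b1 b2 : #|set3 b0 b1 b2| = (b0 + b1 + b2)%N.
Proof.
rewrite -sum1_card big_mkcond !big_ord_recl big_ord0 !inE /=.
by case: b0; case: b1; case: b2.
Qed.

Lemma set3_neq0 b0 b1 b2 : (set3 b0 b1 b2 != finset.set0) = [|| b0, b1 | b2].
Proof. by rewrite -card_gt0 card_set3; case: b0; case: b1; case: b2. Qed.

Lemma set3_support b0 b1 b2 (c0 c1 c2 : nat) :
  (set3 b0 b1 b2 \subset profile_support [tuple c0; c1; c2]) =
  [&& b0 ==> (0 < c0)%N, b1 ==> (0 < c1)%N & b2 ==> (0 < c2)%N].
Proof.
apply/fintype.subsetP/and3P => [sub|[h0 h1 h2] [[|[|[|i]]] lti]].
- split; apply/implyP => b.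
  + by have := sub (@Ordinal 3 0 isT); rewrite !inE /= b => /(_ isT).
  + by have := sub (@Ordinal 3 1 isT); rewrite !inE /= b => /(_ isT).
  + by have := sub (@Ordinal 3 2 isT); rewrite !inE /= b => /(_ isT).
- by rewrite !inE => /(implyP h0).
- by rewrite !inE => /(implyP h1).
- by rewrite !inE => /(implyP h2).
- by [].
Qed.

Lemma shift_profile3 b0 b1 b2 (c0 c1 c2 : nat) :
  shift_profile [tuple c0; c1; c2] (set3 b0 b1 b2) =
  [tuple c0 + b2 - b0; c1 + b0 - b1; c2 + b1 - b2]%N.
Proof.
by apply: eq_from_tnth => -[[|[|[|i]]] lti]; rewrite // tnth_mktuple !inE.
Qed.

(** The seven nonempty subsets, grouped by which of [c1] and [c2] must be positive. [Q] and [D] stay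
    abstract so that the rearrangement is a plain ring identity. *)
Lemma big_bool3_recurrence (R : comPzRingType) (c0 c1 c2 : nat) (Q : nat -> R)
    (D : nat -> 3.-tuple nat -> R) :
    (0 < c0)%N -> Q 0%N = 1 ->
  \sum_(b0 : bool) \sum_(b1 : bool) \sum_(b2 : bool)
    (if [&& b0 ==> (0 < c0)%N, b1 ==> (0 < c1)%N & b2 ==> (0 < c2)%N]
        && [|| b0, b1 | b2] then
       (-1) ^+ (b0 + b1 + b2).-1 * (Q (b0 + b1 + b2).-1 * D (b0 + b1 + b2)%N
         [tuple c0 + b2 - b0; c1 + b0 - b1; c2 + b1 - b2]%N)
     else 0) =
    D 1%N [tuple c0 - 1; c1 + 1; c2]%N
  + (if (0 < c1)%N then D 1%N [tuple c0; c1 - 1; c2 + 1]%N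
       - Q 1%N * D 2%N [tuple c0 - 1; c1; c2 + 1]%N else 0)
  + (if (0 < c2)%N then D 1%N [tuple c0 + 1; c1; c2 - 1]%N
       - Q 1%N * D 2%N [tuple c0; c1 + 1; c2 - 1]%N else 0)
  + (if (0 < c1)%N && (0 < c2)%N then
       Q 2%N * D 3%N [tuple c0; c1; c2]
       - Q 1%N * D 2%N [tuple c0 + 1; c1 - 1; c2]%N else 0).
Proof.
move=> c0_gt0 Q0; rewrite !big_bool /= c0_gt0 /= !addn0 !subn0 !addnK !andbT Q0.
by case: (0 < c1)%N; case: (0 < c2)%N => /=; ring.
Qed.

Lemma Gcyl_recurrence3 (c0 c1 c2 : nat) (Q := qpoch (y * q) q) :
    (0 < c0)%N ->
  Gcyl [tuple c0; c1; c2] =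
    ydil 1 (Gcyl [tuple c0 - 1; c1 + 1; c2]%N)
  + (if (0 < c1)%N then ydil 1 (Gcyl [tuple c0; c1 - 1; c2 + 1]%N)
       - Q 1%N * ydil 2 (Gcyl [tuple c0 - 1; c1; c2 + 1]%N) else 0)
  + (if (0 < c2)%N then ydil 1 (Gcyl [tuple c0 + 1; c1; c2 - 1]%N)
       - Q 1%N * ydil 2 (Gcyl [tuple c0; c1 + 1; c2 - 1]%N) else 0)
  + (if (0 < c1)%N && (0 < c2)%N then
       Q 2%N * ydil 3 (Gcyl [tuple c0; c1; c2])
       - Q 1%N * ydil 2 (Gcyl [tuple c0 + 1; c1 - 1; c2]%N) else 0).
Proof.
move=> c0_gt0; have Q0 : Q 0%N = 1 by rewrite /Q /qpoch big_ord0.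
rewrite [LHS](@Gcyl_recurrence _ _ (@Ordinal 3 0 isT)) // big_set3.
apply: etrans (big_bool3_recurrence c1 c2 (fun j c => ydil j (Gcyl c)) c0_gt0 Q0).
apply: eq_bigr => b0 _; apply: eq_bigr => b1 _; apply: eq_bigr => b2 _.
by rewrite set3_neq0 set3_support card_set3 shift_profile3.
Qed.

Lemma Gcyl_rot3 (a b c : nat) : Gcyl [tuple b; c; a] = Gcyl [tuple a; b; c].
Proof.
rewrite /Gcyl !Fcyl_Hcyl -(Hcyl_rot [tuple a; b; c]).
suff -> : rot_profile [tuple a; b; c] = [tuple b; c; a] by [].
by apply: eq_from_tnth => -[[|[|[|i]]] lti]; rewrite // tnth_mktuple.
Qed.

Lemma Gcyl400 : Gcyl [tuple 4; 0; 0]%N = ydil 1 (Gcyl [tuple 3; 1; 0]%N).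
Proof. by rewrite [LHS]Gcyl_recurrence3 // !addr0. Qed.

Lemma Gcyl310 : Gcyl [tuple 3; 1; 0]%N =
  ydil 1 (Gcyl [tuple 2; 2; 0]%N) + (ydil 1 (Gcyl [tuple 3; 0; 1]%N)
  - qpoch (y * q) q 1 * ydil 2 (Gcyl [tuple 2; 1; 1]%N)).
Proof. by rewrite [LHS]Gcyl_recurrence3 // !addr0. Qed.

Lemma Gcyl301 : Gcyl [tuple 3; 0; 1]%N =
  ydil 1 (Gcyl [tuple 2; 1; 1]%N) + (ydil 1 (Gcyl [tuple 4; 0; 0]%N)
  - qpoch (y * q) q 1 * ydil 2 (Gcyl [tuple 3; 1; 0]%N)).
Proof. by rewrite [LHS]Gcyl_recurrence3 // !addr0. Qed.

Lemma Gcyl220 : Gcyl [tuple 2; 2; 0]%N =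
  ydil 1 (Gcyl [tuple 3; 0; 1]%N) + (ydil 1 (Gcyl [tuple 2; 1; 1]%N)
  - qpoch (y * q) q 1 * ydil 2 (Gcyl [tuple 2; 1; 1]%N)).
Proof.
(* The recurrence at (2,2,0) yields (1,3,0) and (1,2,1), which are rotations of (3,0,1) and
   (2,1,1). *)
rewrite [in RHS](Gcyl_rot3 1 3 0) [X in _ * ydil 2 X](Gcyl_rot3 1 2 1).
by rewrite [LHS]Gcyl_recurrence3 // !addr0.
Qed.

Lemma Gcyl211_expand : Gcyl [tuple 2; 1; 1]%N =
  ydil 1 (Gcyl [tuple 2; 1; 1]%N)
  + (ydil 1 (Gcyl [tuple 2; 2; 0]%N)
     - qpoch (y * q) q 1 * ydil 2 (Gcyl [tuple 2; 1; 1]%N))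
  + (ydil 1 (Gcyl [tuple 3; 1; 0]%N)
     - qpoch (y * q) q 1 * ydil 2 (Gcyl [tuple 2; 2; 0]%N))
  + (qpoch (y * q) q 2 * ydil 3 (Gcyl [tuple 2; 1; 1]%N)
     - qpoch (y * q) q 1 * ydil 2 (Gcyl [tuple 3; 0; 1]%N)).
Proof.
have rot121 := Gcyl_rot3 1 2 1.
have rot112 : Gcyl [tuple 2; 1; 1]%N = Gcyl [tuple 1; 1; 2]%N.
  by rewrite rot121 (Gcyl_rot3 1 1 2).
have rot202 : Gcyl [tuple 2; 2; 0]%N = Gcyl [tuple 2; 0; 2]%N.
  by rewrite (Gcyl_rot3 0 2 2) (Gcyl_rot3 2 0 2).
have E : Gcyl [tuple 2; 1; 1]%N = ydil 1 (Gcyl [tuple 1; 2; 1]%N)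
    + (ydil 1 (Gcyl [tuple 2; 0; 2]%N)
       - qpoch (y * q) q 1 * ydil 2 (Gcyl [tuple 1; 1; 2]%N))
    + (ydil 1 (Gcyl [tuple 3; 1; 0]%N)
       - qpoch (y * q) q 1 * ydil 2 (Gcyl [tuple 2; 2; 0]%N))
    + (qpoch (y * q) q 2 * ydil 3 (Gcyl [tuple 2; 1; 1]%N)
       - qpoch (y * q) q 1 * ydil 2 (Gcyl [tuple 3; 0; 1]%N)).
  exact: (@Gcyl_recurrence3 2 1 1 isT).
by rewrite -rot121 -rot112 -rot202 in E.
Qed.

(* Substituting the equation for (2,2,0) eliminates the second order term. *)
Lemma Gcyl211 : Gcyl [tuple 2; 1; 1]%N =
  ydil 1 (Gcyl [tuple 2; 1; 1]%N) + ydil 1 (Gcyl [tuple 3; 1; 0]%N)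
  + y * q * ydil 1 (Gcyl [tuple 2; 2; 0]%N)
  - qpoch (y * q) q 1 * ydil 2 (Gcyl [tuple 2; 2; 0]%N).
Proof.
(* Here [z] is yq, [Q1'] is 1 - yq^2 and [u] is the dilated series of (2,2,0). The terms in [s211],
   [t] and [s301] add up to [- Q1 * u], and [u - Q1 * u = z * u]. *)
have ringE (R : comPzRingType) (z Q1 Q1' Q2 a b u s301 s211 s220 t : R) :
    Q1 = 1 - z -> Q2 = Q1 * Q1' -> u = s301 + (s211 - Q1' * t) ->
    a + (u - Q1 * s211) + (b - Q1 * s220) + (Q2 * t - Q1 * s301) =
    a + b + z * u - Q1 * s220.
  by move=> -> -> ->; ring.
rewrite [LHS]Gcyl211_expand.
apply: (ringE _ _ _ (ydil 1 (qpoch (y * q) q 1))).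
- by rewrite /qpoch big_ord1 mulr1.
- rewrite qpochS; congr (_ * _).
  rewrite /qpoch big_ord1 mulr1 ydilB ydil1 ydilM ydily expr1.
  by rewrite -[X in ydil 1 X]expr1 ydilq expr1.
- by rewrite [in LHS]Gcyl220 ydilD ydilB (ydilM _ (qpoch _ _ _)) !ydil_add.
Qed.

(** * The system for the coefficients of powers of y, and its uniqueness *)

Local Notation qX := (fpsX int).

(* The functional equations for (4,0,0), (3,1,0), (3,0,1), (2,2,0), (2,1,1), on
   the coefficients of [y ^+ N.+1]. *)
Definition profile_system (g400 g310 g301 g220 g211 : nat -> fps int) : Prop :=
  [/\ g400 0%N = 1, g310 0%N = 1, g301 0%N = 1, g220 0%N = 1 & g211 0%N = 1] /\
  forall N (n := N.+1),
  [/\ g400 n = qX ^+ n * g310 n,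
      g310 n = qX ^+ n * (g220 n + g301 n)
        - (qX ^+ (n * 2) * g211 n - qX * (qX ^+ (N * 2) * g211 N)),
      g301 n = qX ^+ n * (g211 n + g400 n)
        - (qX ^+ (n * 2) * g310 n - qX * (qX ^+ (N * 2) * g310 N)),
      g220 n = qX ^+ n * (g301 n + g211 n)
        - (qX ^+ (n * 2) * g211 n - qX * (qX ^+ (N * 2) * g211 N))
    & g211 n = qX ^+ n * (g211 n + g310 n) + qX * (qX ^+ N * g220 N)
        - (qX ^+ (n * 2) * g220 n - qX * (qX ^+ (N * 2) * g220 N))].

Lemma coef_fpsXn_vanish (f : fps int) n t :
  (0 < n)%N -> (forall s, (s < t)%N -> f s = 0) -> (qX ^+ n * f) t = 0.
Proof.
move=> n_gt0 f0; rewrite fps_coefXnM; case: ltnP => // lent; apply: f0.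
by lia.
Qed.

(** Every right-hand side is divisible by q^n with n > 0, so coefficients of degree t depend only on
    those of lower degree and vanish by strong induction. *)
Lemma homogeneous_system0 (n : nat) (d400 d310 d301 d220 d211 : fps int) :
    (0 < n)%N ->
    d400 = qX ^+ n * d310 ->
    d310 = qX ^+ n * (d220 + d301) - qX ^+ (n * 2) * d211 ->
    d301 = qX ^+ n * (d211 + d400) - qX ^+ (n * 2) * d310 ->
    d220 = qX ^+ n * (d301 + d211) - qX ^+ (n * 2) * d211 ->
    d211 = qX ^+ n * (d211 + d310) - qX ^+ (n * 2) * d220 ->
  [/\ d400 = 0, d310 = 0, d301 = 0, d220 = 0 & d211 = 0].
Proof.
move=> n_gt0 e1 e2 e3 e4 e5.
have n2_gt0 : (0 < n * 2)%N by rewrite muln_gt0 n_gt0.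
suff vanish t : [/\ d400 t = 0, d310 t = 0, d301 t = 0, d220 t = 0 & d211 t = 0].
  by split; apply/fpsP => t; case: (vanish t).
elim/ltn_ind: t => t IH.
have coefB (f g : fps int) : (f - g) t = f t - g t by [].
have coefD (f g : fps int) s : (f + g) s = f s + g s by [].
split; rewrite (e1, e2, e3, e4, e5) ?coefB !coef_fpsXn_vanish ?subr0 //;
  by move=> s /IH[h1 h2 h3 h4 h5]; rewrite ?coefD ?h1 ?h2 ?h3 ?h4 ?h5.
Qed.

(** Once two solutions agree at n - 1, those terms cancel in the difference, which solves the
    homogeneous system at n. *)
Lemma profile_system_unique (g400 g310 g301 g220 g211 : nat -> fps int)
    (h400 h310 h301 h220 h211 : nat -> fps int) :
    profile_system g400 g310 g301 g220 g211 ->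
    profile_system h400 h310 h301 h220 h211 ->
  forall n, [/\ g400 n = h400 n, g310 n = h310 n, g301 n = h301 n,
                g220 n = h220 n & g211 n = h211 n].
Proof.
move=> [[g1 g2 g3 g4 g5] gS] [[h1 h2 h3 h4 h5] hS].
elim=> [|N [_ IH2 _ IH4 IH5]]; first by rewrite g1 g2 g3 g4 g5 h1 h2 h3 h4 h5.
have [e1 e2 e3 e4 e5] := gS N; have [f1 f2 f3 f4 f5] := hS N.
rewrite IH2 IH4 IH5 in e2 e3 e4 e5.
suff : [/\ g400 N.+1 - h400 N.+1 = 0, g310 N.+1 - h310 N.+1 = 0,
    g301 N.+1 - h301 N.+1 = 0, g220 N.+1 - h220 N.+1 = 0
    & g211 N.+1 - h211 N.+1 = 0].
  by case=> d1 d2 d3 d4 d5; split; apply/eqP; rewrite -subr_eq0; apply/eqP.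
apply: (@homogeneous_system0 N.+1) => //.
- by rewrite [in LHS]e1 [in LHS]f1; ring.
- by rewrite [in LHS]e2 [in LHS]f2; ring.
- by rewrite [in LHS]e3 [in LHS]f3; ring.
- by rewrite [in LHS]e4 [in LHS]f4; ring.
- by rewrite [in LHS]e5 [in LHS]f5; ring.
Qed.

Lemma Gcyl_coefy0 (k : nat) (c : k.-tuple nat) : Gcyl c 0%N = 1.
Proof.
have coef0M (f g : series) : (f * g) 0%N = f 0%N * g 0%N.
  by rewrite fps_coefM big_ord1.
have qp0 j : qpoch (y * q) q j 0%N = 1.
  elim: j => [|j IHj]; first by rewrite /qpoch big_ord0.
  rewrite qpochS coef0M IHj mul1r.
  have -> : (1 - y * q * q ^+ j : series) 0%N = 1 - (y * q * q ^+ j) 0%N by [].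
  by rewrite !coef0M /= !mul0r subr0.
have P0 : qpoch_inf (y * q) q 0%N = 1.
  apply/fpsP => n; have [N lim] := qpoch_inf_lim 0 n.
  by rewrite -(lim N) // qp0.
rewrite /Gcyl Fcyl_Hcyl !coef0M P0 Hcyl_coefy0 mul1r mulr1.
by apply/fpsP => n; rewrite /= subr0.
Qed.

Lemma coef_yqM (f : series) N : (y * q * f) N.+1 = qX * f N.
Proof. by rewrite -mulrA /y fps_coefXM /q fps_coefCM. Qed.

Lemma coef_qpoch1M (f : series) N :
  (qpoch (y * q) q 1 * f) N.+1 = f N.+1 - qX * f N.
Proof.
rewrite /qpoch big_ord1 mulr1 mulrBl mul1r.
by have -> : (f - y * q * f) N.+1 = f N.+1 - (y * q * f) N.+1 by [];
  rewrite coef_yqM.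
Qed.

Lemma profile_system_Gcyl :
  profile_system (Gcyl [tuple 4; 0; 0]%N) (Gcyl [tuple 3; 1; 0]%N)
    (Gcyl [tuple 3; 0; 1]%N) (Gcyl [tuple 2; 2; 0]%N) (Gcyl [tuple 2; 1; 1]%N).
Proof.
have coefD (f g : series) n : (f + g) n = f n + g n by [].
have coefB (f g : series) n : (f - g) n = f n - g n by [].
split=> [|N n]; first by rewrite !Gcyl_coefy0.
split.
- by rewrite [in LHS]Gcyl400 ydilE muln1.
- rewrite [in LHS]Gcyl310 coefD coefB coef_qpoch1M !ydilE !muln1.
  by rewrite addrA -mulrDr.
- rewrite [in LHS]Gcyl301 coefD coefB coef_qpoch1M !ydilE !muln1.
  by rewrite addrA -mulrDr.
- rewrite [in LHS]Gcyl220 coefD coefB coef_qpoch1M !ydilE !muln1.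
  by rewrite addrA -mulrDr.
- rewrite [in LHS]Gcyl211 coefB coefD coefD coef_qpoch1M coef_yqM !ydilE !muln1.
  by rewrite -mulrDr.
Qed.

(** * Gaussian binomial sums *)

Definition qexp (n k : nat) : nat := (n ^ 2 + k ^ 2 - n * k)%N.

(** As nk is at most n^2 + k^2, the truncated subtraction is exact. The shift rules below follow
    from this subtraction-free form. *)
Lemma qexpE n k : (qexp n k + n * k = n * n + k * k)%N.
Proof. by rewrite /qexp !expnS !expn0 !muln1 subnK //; nia. Qed.

Lemma qexp_Sl N k : (qexp N.+1 k + k = qexp N k + (2 * N + 1))%N.
Proof. by have := qexpE N k; have := qexpE N.+1 k; nia. Qed.

Lemma qexp_SS N k : (qexp N.+1 k.+1 = qexp N k + (N + 1 + k))%N.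
Proof. by have := qexpE N k; have := qexpE N.+1 k.+1; nia. Qed.

Lemma qexp_Sr N k : (qexp N k.+1 + N = qexp N k + (2 * k + 1))%N.
Proof. by have := qexpE N k; have := qexpE N k.+1; nia. Qed.

Section Gauss.
Variables (R : comPzRingType) (x : R).

(** Gaussian binomials as polynomials in x, built by the q-Pascal rule without division;
    [gauss_xpoch] recovers the quotient formula. *)
Fixpoint gauss (n k : nat) : R :=
  match n, k with
  | _, 0 => 1
  | 0, _.+1 => 0
  | n'.+1, k'.+1 => gauss n' k' + x ^+ k * gauss n' k
  end.

Lemma gaussn0 n : gauss n 0 = 1. Proof. by case: n. Qed.

Lemma gaussSS n k : gauss n.+1 k.+1 = gauss n k + x ^+ k.+1 * gauss n k.+1.
Proof. by []. Qed.

Lemma gauss_small n k : (n < k)%N -> gauss n k = 0.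
Proof.
elim: n k => [|n IHn] [|k] //=; rewrite ltnS => ltnk.
by rewrite !IHn ?mulr0 ?addr0 // ltnW.
Qed.

(** Induction on n by the Pascal rule. For k >= n the truncated exponent n - k is 0 and both sides
    vanish. *)
Lemma gauss_absorb n k :
  (1 - x ^+ (n - k)) * gauss n k = (1 - x ^+ k.+1) * gauss n k.+1.
Proof.
elim: n k => [|n IHn] k; first by case: k => [|k]; rewrite expr0 subrr /= mul0r mulr0.
case: k => [|k].
  rewrite subn0 gaussn0 gaussSS gaussn0 mulrDr mulrCA -IHn subn0 gaussn0 expr1.
  by rewrite exprS; ring.
rewrite subSS [in LHS]gaussSS [in RHS]gaussSS !mulrDr IHn.
have -> : (1 - x ^+ k.+2) * (x ^+ k.+2 * gauss n k.+2) =
    x ^+ k.+2 * ((1 - x ^+ (n - k.+1)) * gauss n k.+1) by rewrite IHn; ring.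
case: (ltnP k n) => [ltkn|lenk]; last first.
  by rewrite (@gauss_small n k.+1) // !mulr0.
have -> : x ^+ (n - k) = x * x ^+ (n - k.+1) by rewrite -exprS subnSK.
by rewrite (exprS x k.+1); ring.
Qed.

(** The second q-Pascal rule; it differs from the first exactly by [gauss_absorb]. *)
Lemma gaussSS_alt n k : gauss n.+1 k.+1 = gauss n k.+1 + x ^+ (n - k) * gauss n k.
Proof.
have := gauss_absorb n k; rewrite !mulrBl !mul1r => /eqP.
rewrite subr_eq => /eqP gE; rewrite gaussSS [in LHS]gE; ring.
Qed.

Lemma gauss_top n k : (k <= n.+1)%N ->
  (1 - x ^+ (n.+1 - k)) * gauss n.+1 k = (1 - x ^+ n.+1) * gauss n k.
Proof.
case: k => [|k]; first by rewrite subn0 !gaussn0.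
rewrite ltnS subSS => lekn; rewrite gaussSS mulrDr gauss_absorb.
have -> : x ^+ n.+1 = x ^+ k.+1 * x ^+ (n - k) by rewrite -exprD addSn subnKC.
by ring.
Qed.

Definition xpoch n : R := \prod_(i < n) (1 - x ^+ i.+1).

Lemma xpochS n : xpoch n.+1 = xpoch n * (1 - x ^+ n.+1).
Proof. by rewrite /xpoch big_ord_recr. Qed.

Lemma gauss_xpoch n k :
  (k <= n)%N -> gauss n k * (xpoch k * xpoch (n - k)) = xpoch n.
Proof.
elim: n k => [|n IHn] [|k] //; rewrite ?gaussn0 ?subn0.
- by rewrite /xpoch big_ord0 !mulr1.
- by rewrite {1}/xpoch big_ord0 !mul1r.
rewrite ltnS subSS => lekn; rewrite gaussSS xpochS mulrDl.
have -> : gauss n k * (xpoch k * (1 - x ^+ k.+1) * xpoch (n - k)) =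
    xpoch n * (1 - x ^+ k.+1) by rewrite -(IHn k) //; ring.
move: lekn; rewrite leq_eqVlt => /predU1P[->|ltkn].
  by rewrite gauss_small // mulr0 mul0r addr0 xpochS.
have -> : x ^+ k.+1 * gauss n k.+1 * (xpoch k * (1 - x ^+ k.+1) * xpoch (n - k)) =
    x ^+ k.+1 * (1 - x ^+ (n - k)) * xpoch n.
  by rewrite -(IHn k.+1) // -subnSK // !xpochS; ring.
rewrite xpochS.
have -> : x ^+ n.+1 = x ^+ k.+1 * x ^+ (n - k) by rewrite -exprD addSn subnKC // ltnW.
by ring.
Qed.

(** The numerators of alpha_n (p = 0) and beta_n (p = 1). The case p = 2 arises in the recurrence
    for p = 0 and is removed by [gsum2]. *)
Definition gsum (n p : nat) : R :=
  \sum_(0 <= k < (2 * n).+1) x ^+ (qexp n k + p * k) * gauss (2 * n) k.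

Lemma big_gauss_widen (K m : nat) (F : nat -> R) : (m < K)%N ->
  \sum_(0 <= k < K) F k * gauss m k = \sum_(0 <= k < m.+1) F k * gauss m k.
Proof.
move=> ltmK; rewrite (big_cat_nat (n := m.+1)) //=.
rewrite [X in _ + X]big_nat_cond [X in _ + X]big1 ?addr0 // => k.
by rewrite andbT => /andP[ltmk _]; rewrite gauss_small // mulr0.
Qed.

Lemma big_gauss_shift (m : nat) (F : nat -> R) :
  \sum_(0 <= k < m.+2) F k * gauss m.+1 k =
  \sum_(0 <= k < m.+1) F k * gauss m k
  + \sum_(0 <= k < m.+1) F k.+1 * x ^+ (m - k) * gauss m k.
Proof.
rewrite -(@big_gauss_widen m.+2) // big_nat_recl // [in RHS]big_nat_recl //.
rewrite !gaussn0 -addrA -big_split; congr (_ + _).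
by apply: eq_bigr => k _; rewrite gaussSS_alt mulrDr mulrA.
Qed.

(** The difference of the sums for p = 0 and p = 1 carries a factor 1 - x^k. After k is shifted by
    one, absorption replaces it by 1 - x^(2N-k), and the two resulting terms are the sums for p = 2
    and p = 1. *)
Lemma gsum2 N : x * gsum N 2 =
  x ^+ N * (gsum N 0 - gsum N 1) + x ^+ (2 * N + 1) * gsum N 1.
Proof.
(* The range is widened by one zero term; as the term k = 0 vanishes too, shifting k restores the
   range of [gsum]. *)
have -> : gsum N 0 - gsum N 1 =
    \sum_(0 <= k < (2 * N).+2) x ^+ qexp N k * (1 - x ^+ k) * gauss (2 * N) k.
  rewrite big_gauss_widen // /gsum -sumrB; apply: eq_bigr => k _.
  by rewrite mul0n mul1n addn0 exprD; ring.
rewrite big_nat_recl // expr0 subrr mulr0 mul0r add0r /gsum !mulr_sumr -big_split.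
apply: eq_big_nat => k /andP[_ lek] /=; rewrite ltnS in lek.
have -> : x ^+ N * (x ^+ qexp N k.+1 * (1 - x ^+ k.+1) * gauss (2 * N) k.+1) =
    x ^+ (qexp N k + (2 * k + 1)) * ((1 - x ^+ (2 * N - k)) * gauss (2 * N) k).
  by rewrite gauss_absorb -qexp_Sr exprD; ring.
rewrite mul1n.
have -> : x ^+ (2 * N + 1) = x * (x ^+ k * x ^+ (2 * N - k)).
  by rewrite -exprD -exprS subnKC // addn1.
by rewrite !exprD expr1; ring.
Qed.

Lemma big_gauss_odd N :
  \sum_(0 <= k < (2 * N).+2) x ^+ (qexp N.+1 k + k) * gauss (2 * N).+1 k =
  x ^+ (2 * N + 1) * gsum N 0 + x ^+ (3 * N + 2) * gsum N 1.
Proof.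
rewrite big_gauss_shift /gsum !mulr_sumr; congr (_ + _).
  apply: eq_big_nat => k _; rewrite mul0n addn0 mulrA -exprD qexp_Sl.
  by rewrite [(_ + (2 * N + 1))%N]addnC.
apply: eq_big_nat => k /andP[_ lek]; rewrite ltnS in lek.
rewrite mulrA -!exprD qexp_SS; congr (x ^+ _ * _).
by move: lek; lia.
Qed.

(** The left side has summands with factor 1 - x^(2n-k), which [gauss_top] trades for 1 - x^(2n)
    while lowering the row from 2n to 2N + 1. *)
Lemma gsum1_rec N (n := N.+1) :
  gsum n 1 - x ^+ (2 * n) * gsum n 0 =
  (1 - x ^+ (2 * n)) *
    (x ^+ (2 * N + 1) * gsum N 0 + x ^+ (3 * N + 2) * gsum N 1).
Proof.
have -> : gsum n 1 - x ^+ (2 * n) * gsum n 0 = (1 - x ^+ (2 * n)) *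
    \sum_(0 <= k < (2 * N).+2) x ^+ (qexp n k + k) * gauss (2 * N).+1 k.
  rewrite -(@big_gauss_widen (2 * n).+1); last by rewrite /n; lia.
  rewrite /gsum !mulr_sumr -sumrB; apply: eq_big_nat => k /andP[_ lek].
  rewrite ltnS in lek; rewrite mul0n mul1n addn0.
  have nE : (2 * n = (2 * N).+2)%N by rewrite /n; lia.
  transitivity (x ^+ (qexp n k + k) * ((1 - x ^+ (2 * n - k)) * gauss (2 * n) k)).
    have -> : x ^+ (2 * n) = x ^+ k * x ^+ (2 * n - k) by rewrite -exprD subnKC.
    by rewrite exprD; ring.
  by rewrite nE gauss_top -?nE //; ring.
by rewrite big_gauss_odd.
Qed.

(** The two Pascal rules are applied in turn, going from row 2n through 2N + 1 to 2N; this leaves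
    sums with p = 0, 1, 2, and [gsum2] removes the last. *)
Lemma gsum0_rec N (n := N.+1) :
  gsum n 0 = (1 + x ^+ n) * x ^+ (2 * N + 1) * gsum N 0
    + (x ^+ (4 * N + 3) + x ^+ (N + 1)) * gsum N 1.
Proof.
have -> : gsum n 0 =
    \sum_(0 <= k < (2 * N).+2) x ^+ (qexp n k + k) * gauss (2 * N).+1 k
  + x ^+ (N + 1) *
    \sum_(0 <= k < (2 * N).+2) x ^+ (qexp N k + k) * gauss (2 * N).+1 k.
  have nE : (2 * n = (2 * N).+2)%N by rewrite /n; lia.
  rewrite -(@big_gauss_widen (2 * N).+3) // /gsum nE.
  rewrite big_nat_recl // [in RHS]big_nat_recl // !gaussn0 mul0n addn0 -addrA.
  congr (_ + _); rewrite mulr_sumr -big_split; apply: eq_bigr => k _.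
  rewrite gaussSS mul0n addn0 mulrDr addrC mulrA -exprD; congr (_ + _).
  by rewrite mulrA -exprD qexp_SS; congr (x ^+ _ * _); lia.
rewrite big_gauss_odd.
have -> : \sum_(0 <= k < (2 * N).+2) x ^+ (qexp N k + k) * gauss (2 * N).+1 k =
    gsum N 1 + x ^+ (N + 1) * (x * gsum N 2).
  rewrite big_gauss_shift /gsum !mulr_sumr; congr (_ + _).
    by apply: eq_big_nat => k _; rewrite mul1n.
  apply: eq_big_nat => k /andP[_ lek]; rewrite ltnS in lek.
  rewrite !mulrA -exprSr -!exprD; congr (x ^+ _ * _).
  by have := qexp_Sr N k; move: lek; lia.
rewrite gsum2 /n.
have -> : x ^+ (3 * N + 2) = x ^+ 2 * x ^+ N ^+ 3.
  by rewrite -exprM -exprD; congr (x ^+ _); lia.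
have -> : x ^+ (4 * N + 3) = x ^+ 3 * x ^+ N ^+ 4.
  by rewrite -exprM -exprD; congr (x ^+ _); lia.
have -> : x ^+ (2 * N + 1) = x * x ^+ N ^+ 2.
  by rewrite -exprM -exprS; congr (x ^+ _); lia.
by rewrite addn1 (exprS x N); ring.
Qed.

End Gauss.

(** * The sums satisfy the system *)

Lemma fpsC_is_zmod_morphism (R : comUnitRingType) : zmod_morphism (@fpsC R).
Proof.
by move=> a b; apply/fpsP => n /=; case: eqP => // _; rewrite subr0.
Qed.

Lemma fpsC_is_monoid_morphism (R : comUnitRingType) : monoid_morphism (@fpsC R).
Proof.
split=> // a b; apply/fpsP => n; rewrite fps_coefCM /=.
by case: eqP => // _; rewrite mulr0.
Qed.

HB.instance Definition _ (R : comUnitRingType) :=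
  GRing.isZmodMorphism.Build R (fps R) (@fpsC R) (@fpsC_is_zmod_morphism R).
HB.instance Definition _ (R : comUnitRingType) :=
  GRing.isMonoidMorphism.Build R (fps R) (@fpsC R) (@fpsC_is_monoid_morphism R).

Lemma xpoch_unit n : xpoch qX n \is a GRing.unit.
Proof.
apply: rpred_prod => i _; rewrite unfold_in /= /fps_unit.
have -> : (1 - qX ^+ i.+1) 0%N = 1 - (qX ^+ i.+1 * 1) 0%N by rewrite mulr1.
by rewrite fps_coefXnM subr0 unitr1.
Qed.

Lemma qpoch_fpsC n : qpoch q q n = fpsC (xpoch qX n).
Proof.
rewrite rmorph_prod; apply: eq_bigr => i _.
by rewrite rmorphB rmorph1 rmorphXn -exprS.
Qed.

Lemma qbinom_fpsC n k : (k <= n)%N -> qbinom n k = fpsC (gauss qX n k).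
Proof.
move=> lekn; rewrite /qbinom !qpoch_fpsC -rmorphM -(gauss_xpoch qX lekn).
by rewrite [in X in X / _]rmorphM mulrK // rmorph_unit // unitrM !xpoch_unit.
Qed.

(** The n-th member is homogeneous of degree n in y, so only the m-th one contributes to the
    coefficient of y^m. *)
Lemma series_sum_y (A : set nat) (f : nat -> series) (a : nat -> fps int) m :
    (forall n, A n -> f n = y ^+ n * fpsC (a n)) ->
  series_sum A f m = if m \in A then a m else 0.
Proof.
move=> fE; apply/fpsP => t; rewrite /series_sum /=.
have fcoef n : A n -> f n m t = if n == m then a m t else 0.
  move=> /fE ->; rewrite series_coefMyX /=.
  case: ltngtP => [//|ltnm|->]; last by rewrite subnn.
  by rewrite subn_eq0 leqNgt ltnm.
case: ifPn => [|]; rewrite (inE, notin_setE) => mA.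
  rewrite -(@fsbig_widen _ _ _ _ [set m]).
  - by rewrite fsbig_set1 fcoef // eqxx.
  - by move=> _ ->.
  - by move=> n [nA /= /eqP/negbTE nm]; rewrite fcoef // nm.
rewrite fsbig1 // => n nA; rewrite fcoef //.
by case: eqP => // nm; rewrite nm in nA.
Qed.

Definition alpha n : fps int := gsum qX n 0 / xpoch qX n.
Definition beta n : fps int := gsum qX n 1 / xpoch qX n.


Lemma alpha_rec N (n := N.+1) : (1 - qX ^+ n) * alpha n =
  (1 + qX ^+ n) * qX ^+ (2 * N + 1) * alpha N
  + (qX ^+ (4 * N + 3) + qX ^+ (N + 1)) * beta N.
Proof.
have := xpoch_unit n; rewrite /n xpochS unitrM => /andP[uN un].
rewrite /alpha /beta xpochS invrM // gsum0_rec mulrCA mulVKr //.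
by rewrite mulrDl !mulrA.
Qed.

(** The factor 1 - q^(2n) in [gsum1_rec] splits as (1 - q^n)(1 + q^n), and 1 - q^n cancels the last
    factor of (q;q)_n. *)
Lemma beta_rec N (n := N.+1) : beta n = qX ^+ (2 * n) * alpha n
  + (1 + qX ^+ n) * (qX ^+ (2 * N + 1) * alpha N + qX ^+ (3 * N + 2) * beta N).
Proof.
have := xpoch_unit n; rewrite /n xpochS unitrM => /andP[uN un].
have gE : gsum qX n 1 = qX ^+ (2 * n) * gsum qX n 0 + (1 - qX ^+ n) *
    ((1 + qX ^+ n) *
     (qX ^+ (2 * N + 1) * gsum qX N 0 + qX ^+ (3 * N + 2) * gsum qX N 1)).
  apply/eqP; rewrite -subr_eq0 opprD addrA gsum1_rec subr_eq0; apply/eqP.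
  by rewrite mulrA [(2 * _)%N]mulnC exprM -subr_sqr expr1n.
rewrite /beta {1}gE /alpha mulrDl -mulrA; congr (_ + _).
have divE (R : comUnitRingType) (w p s t g h : R) :
    1 - w \is a GRing.unit -> p \is a GRing.unit ->
    (1 - w) * ((1 + w) * (s * g + t * h)) / (p * (1 - w)) =
    (1 + w) * (s * (g / p) + t * (h / p)).
  move=> uw up; rewrite invrM // mulrACA divrr // mul1r -mulrA.
  by rewrite [(_ + t * h) / p]mulrDl -!mulrA.
by rewrite xpochS divE.
Qed.

Lemma alpha0 : alpha 0 = 1.
Proof. by rewrite /alpha /gsum /xpoch big_nat1 big_ord0 gaussn0 divr1 mulr1. Qed.

Lemma beta0 : beta 0 = 1.
Proof. by rewrite /beta /gsum /xpoch big_nat1 big_ord0 gaussn0 divr1 mulr1. Qed.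

(** The coefficient of y^n on the sum side for (3,0,1). By [qexp_Sl], the exponent of the second
    double sum is that of beta_(n-1) plus 2(n-1) + 1. *)
Definition sum301 n : fps int :=
  qX ^+ n * alpha n + (if n is N.+1 then qX ^+ (2 * N + 1) * beta N else 0).

Definition sum220 n : fps int :=
  qX ^+ n * alpha n + (if n is N.+1 then
    qX ^+ (2 * N + 1) * alpha N + qX ^+ (3 * N + 2) * beta N else 0).

(** A restatement of [beta_rec], which removes [sum220 N] from the fifth equation, where it occurs
    with the factor 1 + q^N. *)
Lemma sum220E n : (1 + qX ^+ n) * sum220 n = qX ^+ n * alpha n + beta n.
Proof.
case: n => [|N]; first by rewrite /sum220 alpha0 beta0 expr0 !mul1r addr0 mulr1.
rewrite /sum220 beta_rec [(2 * N.+1)%N]mulnC exprM.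
by move: (qX ^+ N.+1) (_ * alpha N + _ * beta N) (alpha _) => z t a; ring.
Qed.

Lemma profile_system_sums :
  profile_system (fun n => qX ^+ n * beta n) beta sum301 sum220 alpha.
Proof.
split=> [|N n].
  by rewrite /sum301 /sum220 alpha0 beta0 expr0 !mul1r !addr0.
have zE : qX ^+ n = qX * qX ^+ N by rewrite exprS.
have z2E : qX ^+ (2 * N + 1) = qX * qX ^+ N ^+ 2.
  by rewrite -exprM -exprS; congr (qX ^+ _); lia.
have z3E : qX ^+ (3 * N + 2) = qX ^+ 2 * qX ^+ N ^+ 3.
  by rewrite -exprM -exprD; congr (qX ^+ _); lia.
have z4E : qX ^+ (4 * N + 3) = qX ^+ 3 * qX ^+ N ^+ 4.
  by rewrite -exprM -exprD; congr (qX ^+ _); lia.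
have h1 := alpha_rec N; have h2 := beta_rec N; have h3 := sum220E N.
have s301 : sum301 n = qX ^+ n * alpha n + qX ^+ (2 * N + 1) * beta N by [].
have s220 : sum220 n = qX ^+ n * alpha n
  + (qX ^+ (2 * N + 1) * alpha N + qX ^+ (3 * N + 2) * beta N) by [].
rewrite s301 s220 !exprM z2E z3E zE.
cbv zeta in h1, h2; rewrite -/n (addn1 N) -/n z2E z4E zE in h1.
rewrite -/n [(2 * n)%N]mulnC exprM z2E z3E zE in h2.
(* With x = q and z = q^N the five equations become polynomial consequences of [alpha_rec],
   [beta_rec] and [sum220E]. *)
have ringE (R : comPzRingType) (x z an bn aN bN sN : R) :
    (1 - x * z) * an = (1 + x * z) * (x * z ^+ 2) * aN
      + (x ^+ 3 * z ^+ 4 + x * z) * bN ->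
    bn = (x * z) ^+ 2 * an
      + (1 + x * z) * (x * z ^+ 2 * aN + x ^+ 2 * z ^+ 3 * bN) ->
    (1 + z) * sN = z * aN + bN ->
  [/\ x * z * bn = x * z * bn,
      bn = x * z * (x * z * an + (x * z ^+ 2 * aN + x ^+ 2 * z ^+ 3 * bN)
             + (x * z * an + x * z ^+ 2 * bN))
           - ((x * z) ^+ 2 * an - x * (z ^+ 2 * aN)),
      x * z * an + x * z ^+ 2 * bN = x * z * (an + x * z * bn)
           - ((x * z) ^+ 2 * bn - x * (z ^+ 2 * bN)),
      x * z * an + (x * z ^+ 2 * aN + x ^+ 2 * z ^+ 3 * bN) =
        x * z * (x * z * an + x * z ^+ 2 * bN + an)
           - ((x * z) ^+ 2 * an - x * (z ^+ 2 * aN))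
    & an = x * z * (an + bn) + x * (z * sN)
        - ((x * z) ^+ 2 * (x * z * an + (x * z ^+ 2 * aN + x ^+ 2 * z ^+ 3 * bN))
           - x * (z ^+ 2 * sN))].
  move=> k1 k2 k3; split; rewrite ?k2; try by ring.
  have -> : x * z * (an + ((x * z) ^+ 2 * an
      + (1 + x * z) * (x * z ^+ 2 * aN + x ^+ 2 * z ^+ 3 * bN))) + x * (z * sN)
      - ((x * z) ^+ 2 * (x * z * an + (x * z ^+ 2 * aN + x ^+ 2 * z ^+ 3 * bN))
           - x * (z ^+ 2 * sN)) =
    x * z * an + x * z * ((1 + z) * sN)
    + x * z * (x * z ^+ 2 * aN + x ^+ 2 * z ^+ 3 * bN) by ring.
  (* [alpha_rec] determines only (1 - xz) [an], so this multiple is split off. *)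
  rewrite [LHS](_ : an = x * z * an + (1 - x * z) * an); last by ring.
  by rewrite k3 k1; ring.
exact: ringE.
Qed.


(** * The double sums of the statement in terms of [alpha] and [beta] *)

Lemma q_fpsC k : q ^+ k = fpsC (qX ^+ k).
Proof. exact: fpsCX. Qed.

Lemma sum_y_qbinom n m M (b : nat -> fps int) :
  \sum_(0 <= k < M.+1) y ^+ n * (fpsC (b k) / qpoch q q m) * qbinom M k =
  y ^+ n * fpsC ((\sum_(0 <= k < M.+1) b k * gauss qX M k) / xpoch qX m).
Proof.
rewrite mulr_suml rmorph_sum mulr_sumr; apply: eq_big_nat => k /andP[_ lek].
rewrite qpoch_fpsC qbinom_fpsC // -rmorphV ?xpoch_unit // -mulrA -!rmorphM.
by rewrite mulrAC.
Qed.

Lemma series_sumT (f : nat -> series) (a : nat -> fps int) m :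
  (forall n, f n = y ^+ n * fpsC (a n)) -> series_sum [set: nat] f m = a m.
Proof. by move=> fE; rewrite (@series_sum_y _ _ a) // in_setT. Qed.

Lemma series_sum_pos (f : nat -> series) (a : nat -> fps int) m :
  (forall N, f N.+1 = y ^+ N.+1 * fpsC (a N)) ->
  series_sum [set n | (1 <= n)%N] f m = if m is N.+1 then a N else 0.
Proof.
move=> fE; rewrite (@series_sum_y _ _ (fun n => a n.-1)) => [|[|n] //].
by case: m => [|m]; case: ifPn; rewrite (inE, notin_setE) //= => /negP.
Qed.

Lemma gsum_fpsC n m p r (e : nat -> nat) :
    (forall k, e k = qexp n k + p * k + r)%N ->
  (\sum_(0 <= k < (2 * n).+1) qX ^+ e k * gauss qX (2 * n) k) / xpoch qX m =
  qX ^+ r * (gsum qX n p / xpoch qX m).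
Proof.
move=> eE; rewrite mulrA; congr (_ / _); rewrite /gsum mulr_sumr.
by apply: eq_bigr => k _; rewrite eE exprD [_ * qX ^+ r]mulrC mulrA.
Qed.

Lemma sum_alpha n r :
  \sum_(0 <= k < (2 * n).+1) y ^+ n * q ^+ (n ^ 2 + k ^ 2 - n * k)
    * (q ^+ r / qpoch q q n) * qbinom (2 * n) k =
  y ^+ n * fpsC (qX ^+ r * alpha n).
Proof.
rewrite /alpha -(@gsum_fpsC _ _ _ _ (fun k => qexp n k + r)%N) => [|k].
  rewrite -sum_y_qbinom; apply: eq_bigr => k _.
  by rewrite -q_fpsC exprD -!mulrA.
by rewrite mul0n addn0.
Qed.

Lemma sum_beta n r :
  \sum_(0 <= k < (2 * n).+1)
    y ^+ n * (q ^+ (n ^ 2 + k ^ 2 - n * k + r + k) / qpoch q q n)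
    * qbinom (2 * n) k =
  y ^+ n * fpsC (qX ^+ r * beta n).
Proof.
rewrite /beta -(@gsum_fpsC _ _ _ _ (fun k => qexp n k + r + k)%N) => [|k].
  by rewrite -sum_y_qbinom; apply: eq_bigr => k _; rewrite q_fpsC.
by rewrite mul1n addnAC.
Qed.

Lemma sum301_second N :
  \sum_(0 <= k < (2 * N.+1 - 2).+1) y ^+ N.+1 * q ^+ (N.+1 ^ 2 + k ^ 2 - N.+1 * k)
    * (q ^+ (2 * k) / qpoch q q (N.+1 - 1)) * qbinom (2 * N.+1 - 2) k =
  y ^+ N.+1 * fpsC (qX ^+ (2 * N + 1) * beta N).
Proof.
have -> : (2 * N.+1 - 2 = 2 * N)%N by lia.
rewrite subn1 /= /beta.
rewrite -(@gsum_fpsC _ _ _ _ (fun k => qexp N.+1 k + 2 * k)%N) => [|k].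
  rewrite -sum_y_qbinom; apply: eq_bigr => k _.
  by rewrite -q_fpsC exprD -!mulrA.
by have := qexp_Sl N k; lia.
Qed.

Lemma sum220_second N :
  \sum_(0 <= k < (2 * N.+1 - 2).+1) y ^+ N.+1 * q ^+ (N.+1 ^ 2 + k ^ 2 - N.+1 * k)
    * (q ^+ k * (1 + q ^+ (N.+1 + k)) / qpoch q q (N.+1 - 1))
    * qbinom (2 * N.+1 - 2) k =
  y ^+ N.+1 * fpsC (qX ^+ (2 * N + 1) * alpha N + qX ^+ (3 * N + 2) * beta N).
Proof.
have -> : (2 * N.+1 - 2 = 2 * N)%N by lia.
have ringE (R : comUnitRingType) (s t u v w p : R) :
    s * t * (u * (1 + v) / p) * w = s * (t * u / p) * w + s * (t * u * v / p) * w.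
  by ring.
rewrite subn1 /= /alpha /beta rmorphD mulrDr.
(* The summand 1 of 1 + q^(n+k) gives the [alpha N] term, the summand q^(n+k) the [beta N] term;
   both exponents come from [qexp_Sl]. *)
rewrite -(@gsum_fpsC _ _ _ _ (fun k => qexp N.+1 k + k)%N) => [|k]; last first.
  by have := qexp_Sl N k; lia.
rewrite -(@gsum_fpsC _ _ 1 _ (fun k => qexp N.+1 k + k + (N.+1 + k))%N) => [|k].
  rewrite -!sum_y_qbinom -big_split; apply: eq_bigr => k _.
  rewrite -!q_fpsC (exprD q (_ + _) (N.+1 + k)) (exprD q (qexp _ _) k).
  exact: ringE.
by have := qexp_Sl N k; lia.
Qed.

Theorem theorem3p2 :
  [/\ Gcyl [tuple 4; 0; 0]%N =
        series_sum [set: nat] (fun n1 => \sum_(0 <= n2 < (2 * n1).+1%N)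
          y ^+ n1 * (q ^+ (n1 ^ 2 + n2 ^ 2 - n1 * n2 + n1 + n2) / qpoch q q n1)
          * qbinom (2 * n1) n2),
      Gcyl [tuple 3; 1; 0]%N =
        series_sum [set: nat] (fun n1 => \sum_(0 <= n2 < (2 * n1).+1%N)
          y ^+ n1 * (q ^+ (n1 ^ 2 + n2 ^ 2 - n1 * n2 + n2) / qpoch q q n1)
          * qbinom (2 * n1) n2),
      Gcyl [tuple 3; 0; 1]%N =
        series_sum [set: nat] (fun n1 => \sum_(0 <= n2 < (2 * n1).+1%N)
          y ^+ n1 * q ^+ (n1 ^ 2 + n2 ^ 2 - n1 * n2)
          * (q ^+ n1 / qpoch q q n1) * qbinom (2 * n1) n2)
        + series_sum [set n1 : nat | (1 <= n1)%N]
            (fun n1 => \sum_(0 <= n2 < (2 * n1 - 2).+1%N)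
          y ^+ n1 * q ^+ (n1 ^ 2 + n2 ^ 2 - n1 * n2)
          * (q ^+ (2 * n2) / qpoch q q (n1 - 1)) * qbinom (2 * n1 - 2) n2),
      Gcyl [tuple 2; 2; 0]%N =
        series_sum [set: nat] (fun n1 => \sum_(0 <= n2 < (2 * n1).+1%N)
          y ^+ n1 * q ^+ (n1 ^ 2 + n2 ^ 2 - n1 * n2)
          * (q ^+ n1 / qpoch q q n1) * qbinom (2 * n1) n2)
        + series_sum [set n1 : nat | (1 <= n1)%N]
            (fun n1 => \sum_(0 <= n2 < (2 * n1 - 2).+1%N)
          y ^+ n1 * q ^+ (n1 ^ 2 + n2 ^ 2 - n1 * n2)
          * (q ^+ n2 * (1 + q ^+ (n1 + n2)) / qpoch q q (n1 - 1))
          * qbinom (2 * n1 - 2) n2)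
    & Gcyl [tuple 2; 1; 1]%N =
        series_sum [set: nat] (fun n1 => \sum_(0 <= n2 < (2 * n1).+1%N)
          y ^+ n1 * (q ^+ (n1 ^ 2 + n2 ^ 2 - n1 * n2) / qpoch q q n1)
          * qbinom (2 * n1) n2)].
Proof.
have sys := profile_system_unique profile_system_Gcyl profile_system_sums.
split; apply/fpsP => m; have [e400 e310 e301 e220 e211] := sys m.
- rewrite e400; apply/esym/(@series_sumT _ (fun n => qX ^+ n * beta n)) => n.
  exact: sum_beta.
- rewrite e310; apply/esym/(@series_sumT _ beta) => n.
  (* A factor q^0 is inserted so that [sum_beta] applies with [r = 0]. *)
  rewrite -[beta n]mul1r -[X in fpsC (X * _)]/(qX ^+ 0) -sum_beta.
  by apply: eq_bigr => k _; rewrite addn0.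
- rewrite e301; congr (_ + _).
    by apply/esym/(@series_sumT _ (fun n => qX ^+ n * alpha n)) => n; rewrite sum_alpha.
  by apply/esym/(@series_sum_pos _ (fun N => qX ^+ (2 * N + 1) * beta N));
    exact: sum301_second.
- rewrite e220; congr (_ + _).
    by apply/esym/(@series_sumT _ (fun n => qX ^+ n * alpha n)) => n; rewrite sum_alpha.
  by apply/esym/(@series_sum_pos _ (fun N =>
    qX ^+ (2 * N + 1) * alpha N + qX ^+ (3 * N + 2) * beta N));
    exact: sum220_second.
- rewrite e211; apply/esym/(@series_sumT _ alpha) => n.
  rewrite -[alpha n]mul1r -[X in fpsC (X * _)]/(qX ^+ 0) -sum_alpha.
  by apply: eq_bigr => k _; rewrite expr0 mul1r -!mulrA.
Qed.
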